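(* The colored $(q,r)$-Eulerian polynomials satisfy, for all $n\ge0$, $$A_{n+1}^{(l)}(t,r,q)=(r+t[l-1]_tq^n)A_n^{(l)}(t,r,q)+t[l]_t\sum_{k=0}^{n-1}{n\brack k}_{q}q^{k}A_k^{(l)}(t,r,q)A_{n-k}^{(l)}(t,q),$$ with $A_0^{(l)}(t,r,q)=1$.
   Context: $[m]_t=1+t+\dots+t^{m-1}$ ($[0]_t=0$); ${n\brack k}_q=\frac{(q;q)_n}{(q;q)_k(q;q)_{n-k}}$, $(q;q)_m=\prod_{i=1}^m(1-q^i)$. $C_l\wr\mathfrak{S}_n$ is the set of words $\pi=\pi_1\cdots\pi_n$ with $\pi_i=|\pi_i|^{\epsilon_i}$, $\epsilon_i\in\{0,\dots,l-1\}$, $|\pi_1|\cdots|\pi_n|\in\mathfrak{S}_n$. Order colored integers by $u^a<v^b$ iff $a>b$, or $a=b$ and $u<v$. $\mathrm{maj}(\pi)=\sum\{i\in[n-1]:\pi_i>\pi_{i+1}\}$; $\mathrm{exc}(\pi)$ is the number of $i$ with $\epsilon_i=0$ and $|\pi_i|>i$; $\mathrm{fexc}(\pi)=l\,\mathrm{exc}(\pi)+\sum_i\epsilon_i$; $\mathrm{fix}(\pi)=|\{i:\pi_i=i^0\}|$. $A_n^{(l)}(t,r,q)=\sum_{\pi\in C_l\wr\mathfrak{S}_n}t^{\mathrm{fexc}(\pi)}r^{\mathrm{fix}(\pi)}q^{(\mathrm{maj}-\mathrm{exc})\pi}$ and $A_n^{(l)}(t,q)=A_n^{(l)}(t,1,q)$.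 *)

(* Defs.v *)
From mathcomp Require Import all_boot all_order all_algebra all_fingroup.
Set Implicit Arguments. Unset Strict Implicit. Unset Printing Implicit Defensive.
Import Order.TTheory GRing.Theory Num.Theory.
Local Open Scope ring_scope.

(* A colored permutation pi in C_l wr S_n is encoded as a pair (s, e) with
   s : {perm 'I_n} and e : {ffun 'I_n -> 'I_l}.  Positions are 0-based here:
   position i (0-based) is position i+1 of the paper, and
   pi_{i+1} = (s i + 1)^(e i).  So |pi_{i+1}| = s i + 1, eps_{i+1} = e i. *)
Definition colperm (l n : nat) : finType := ({perm 'I_n} * {ffun 'I_n -> 'I_l})%type.

Definition qint (R : pzRingType) (t : R) (m : nat) : R := \sum_(i < m) t ^+ i.

Definition qpoch (R : pzRingType) (q : R) (m : nat) : R := \prod_(1 <= i < m.+1) (1 - q ^+ i).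

Definition qbinom (R : fieldType) (q : R) (n k : nat) : R :=
  qpoch q n / (qpoch q k * qpoch q (n - k)).

Section Stats.
Variables (l n : nat).
Implicit Type pi : colperm l n.

Definition col_lt (u a v b : nat) : bool := (b < a)%N || ((a == b) && (u < v)%N).

(* pi_{i+1} > pi_{i+2} in 1-based terms, i.e. i+1 is a descent *)
Definition is_desc pi (i : nat) : bool :=
  [exists j : 'I_n, [exists j' : 'I_n, [&& val j == i, val j' == i.+1 &
     col_lt (pi.1 j') (pi.2 j') (pi.1 j) (pi.2 j)]]].

Definition maj pi : nat := \sum_(0 <= i < n.-1 | is_desc pi i) i.+1.

Definition exc pi : nat := #|[set i : 'I_n | (val (pi.2 i) == 0%N) && (i < pi.1 i)%N]|.

Definition fexc pi : nat := l * exc pi + \sum_(i : 'I_n) val (pi.2 i).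

Definition fixc pi : nat := #|[set i : 'I_n | (val (pi.2 i) == 0%N) && (pi.1 i == i)]|.

End Stats.

Definition Acol (R : fieldType) (l n : nat) (t r q : R) : R :=
  \sum_(pi : colperm l n)
     t ^+ fexc pi * r ^+ fixc pi * q ^ ((maj pi)%:Z - (exc pi)%:Z).

Definition Acol1 (R : fieldType) (l n : nat) (t q : R) : R := Acol l n t 1 q.

(* Main.v *)
(** Let D(z) = e(t^l z) - t e(z) with e(z) = sum_n z^n / (q;q)_n, and let F(z) be
    the generating function sum_n A_n(t,r,q) z^n / (q;q)_n.  The recurrence
    follows from D F = (1 - t) e(r z) by comparison with its image under z -> q z.

    To prove this identity, attach to each position of a colored permutation a
    class: 0 for an excedance, l - a for a letter of color a > 0, and l for the
    other letters of color 0.  Then fexc is the sum of the l - class, and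
    maj - exc is the sum of the descents of the sequence of pairs (class, letter).
    Hence A_n / (q;q)_n is a sum of q^(s_1 + ... + s_n) over pairs of a colored
    permutation and a weakly decreasing sequence s_1 >= ... >= s_n >= 0 that drops
    at these descents.  Grouping by the level sets of s, the blocks, reduces the
    identity to one for the number of permutations that are increasing on each
    block.  Such a permutation is the stable sorting of the word that records, at
    each value, the block and the class of that value; excedances and fixed points
    are local conditions on this word, so the count is a coefficient of a product
    of one polynomial per block, and there the identity telescopes.

    As 1 - q^(n+1) may vanish, the recurrence is first proved for indeterminate
    q and t, in the form with Gaussian polynomials, and then specialized. *)
Require Import Defs.
From mathcomp Require Import all_boot all_order all_algebra all_fingroup.
From mathcomp Require Import mpoly.
From mathcomp Require Import zify ring.
Set Implicit Arguments.
Unset Strict Implicit.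
Unset Printing Implicit Defensive.
Import Order.TTheory GRing.Theory Num.Theory.
Local Open Scope ring_scope.

(** * Sums over level sequences *)

Lemma sum_triangle (V : nmodType) (f : nat -> nat -> V) n :
  \sum_(N < n) \sum_(k < N.+1) f N k =
  \sum_(k < n) \sum_(M < n - k) f (M + k)%N k.
Proof.
elim: n => [|n IH]; first by rewrite !big_ord0.
rewrite big_ord_recr [RHS]big_ord_recr /= IH subSnn.
rewrite big_ord_recr big_ord1 /= add0n addrA -big_split /=; congr (_ + _).
apply: eq_bigr => k _; have kn := ltn_ord k.
by rewrite subSn ?(ltnW kn) // big_ord_recr /= subnK // ltnW.
Qed.

Section LevelSum.
Variables (K : fieldType) (q : K).
Hypothesis q_generic : forall i, (0 < i)%N -> q ^+ i != 1.

Lemma qpochS m : qpoch q m.+1 = qpoch q m * (1 - q ^+ m.+1).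
Proof. by rewrite /qpoch big_nat_recr. Qed.

Lemma qpoch0 : qpoch q 0 = 1.
Proof. by rewrite /qpoch big_geq. Qed.

Lemma oneBq_neq0 n : 1 - q ^+ n.+1 != 0.
Proof. by rewrite subr_eq0 eq_sym q_generic. Qed.

Lemma qpoch_neq0 m : qpoch q m != 0.
Proof.
elim: m => [|m IH]; first by rewrite qpoch0 oner_neq0.
by rewrite qpochS mulf_neq0 // oneBq_neq0.
Qed.

(* [level_sum n c] is the sum of [c [:: m_0; m_1; ...] * q ^ (\sum_i i * m_i)]
   over all infinite sequences of multiplicities with [\sum_i m_i = n], for a
   [c] that does not see zero entries; splitting off the least nonempty level
   turns this into a finite recursion. *)
Fixpoint level_sum_rec (fuel n : nat) (c : seq nat -> K) : K :=
  match fuel with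
  | 0 => c [::]
  | f.+1 => if n == 0%N then c [::] else
     (1 - q ^+ n)^-1 *
       \sum_(N < n) q ^+ N * level_sum_rec f N (fun s => c ((n - N)%N :: s))
  end.

Definition level_sum n c := level_sum_rec n n c.

Lemma level_sum_rec_fuel f n c :
  (n <= f)%N -> level_sum_rec f n c = level_sum n c.
Proof.
rewrite /level_sum; elim/ltn_ind: n f c => [[|n]] IH [|f] c //= nf.
congr (_ * _); apply: eq_bigr => N _; congr (_ * _).
have Nn := ltn_ord N.
rewrite (IH N Nn f); last by rewrite -ltnS (leq_trans Nn).
by rewrite (IH N Nn n).
Qed.

Lemma level_sum0 c : level_sum 0 c = c [::].
Proof. by []. Qed.

(** Raising every level by one multiplies the weight by [q ^+ n], so the sequences with [m_0 = 0]
    contribute [q ^+ n] times the whole sum; the others have [m_0 = n - N > 0]. *)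
Lemma level_sumS n c : (1 - q ^+ n) * level_sum n c =
  \sum_(N < n) q ^+ N * level_sum N (fun s => c ((n - N)%N :: s)).
Proof.
case: n => [|n]; first by rewrite expr0 subrr mul0r big_ord0.
rewrite /level_sum /= mulrA divff ?oneBq_neq0 // mul1r.
by apply: eq_bigr => N _; rewrite level_sum_rec_fuel // -ltnS.
Qed.

Lemma oneBq_mulI n : injective ( *%R (1 - q ^+ n.+1)).
Proof. exact: mulfI (oneBq_neq0 n). Qed.

Lemma eq_level_sum n c c' :
  (forall s, sumn s = n -> c s = c' s) -> level_sum n c = level_sum n c'.
Proof.
elim/ltn_ind: n c c' => [[|n]] IH c c' ecc'; first by rewrite !level_sum0 ecc'.
apply: (@oneBq_mulI n); rewrite !level_sumS.
apply: eq_bigr => N _; congr (_ * _); apply: IH => // s sN.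
by apply: ecc'; rewrite /= sN subnK // ltnW.
Qed.

Lemma level_sum_sum (I : finType) n (F : I -> seq nat -> K) :
  level_sum n (fun s => \sum_i F i s) = \sum_i level_sum n (F i).
Proof.
elim/ltn_ind: n F => [[|n]] IH F; first by rewrite level_sum0.
apply: (@oneBq_mulI n); rewrite level_sumS [RHS]mulr_sumr.
under [RHS]eq_bigr do rewrite level_sumS.
rewrite exchange_big /=; apply: eq_bigr => N _.
by rewrite IH // mulr_sumr.
Qed.

Lemma level_sumZ n a c :
  level_sum n (fun s => a * c s) = a * level_sum n c.
Proof.
elim/ltn_ind: n c => [[|n]] IH c; first by rewrite !level_sum0.
apply: (@oneBq_mulI n); rewrite [RHS]mulrCA !level_sumS mulr_sumr.
by apply: eq_bigr => N _; rewrite IH // [RHS]mulrCA.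
Qed.

Lemma level_sumD n c c' :
  level_sum n (fun s => c s + c' s) = level_sum n c + level_sum n c'.
Proof.
elim/ltn_ind: n c c' => [[|n]] IH c c'; first by rewrite !level_sum0.
apply: (@oneBq_mulI n); rewrite mulrDr !level_sumS -big_split /=.
by apply: eq_bigr => N _; rewrite IH // mulrDr.
Qed.

(** On generating functions with one variable [x_i] per entry, this is multiplication by the product
    of the geometric series 1 / (1 - a x_i). *)
Fixpoint conv (a : K) (c : seq nat -> K) (s : seq nat) : K :=
  match s with
  | [::] => c [::]
  | m :: s' =>
      \sum_(j < m.+1) a ^+ j * conv a (fun u => c ((m - j)%N :: u)) s'
  end.

Lemma eq_conv a c c' s :
  (forall u, size u = size s -> c u = c' u) -> conv a c s = conv a c' s.
Proof.
elim: s c c' => [|m s IH] c c' e /=; first exact: e.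
apply: eq_bigr => j _; congr (_ * _); apply: IH => u us.
by apply: e; rewrite /= us.
Qed.

Lemma conv_cons0 a c s : conv a c (0%N :: s) = conv a (fun u => c (0%N :: u)) s.
Proof. by rewrite /= big_ord1 mul1r. Qed.

Lemma conv_consS a c m s : conv a c (m.+1 :: s) =
  a * conv a c (m :: s) + conv a (fun u => c (m.+1 :: u)) s.
Proof.
rewrite [LHS]/= big_ord_recl /= mul1r addrC; congr (_ + _).
rewrite mulr_sumr; apply: eq_bigr => j _.
by rewrite exprS mulrA.
Qed.

Definition zero_blind (c : seq nat -> K) :=
  forall s1 s2, c (s1 ++ 0%N :: s2) = c (s1 ++ s2).

(** Over all levels, [conv] brings in the product of the 1 / (1 - a z q^i), which Euler's identity
    expands as the sum of a^k z^k / (q;q)_k. The induction peels off the lowest level instead of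
    handling infinite products. *)
Lemma level_sum_conv a c n : zero_blind c ->
  level_sum n (conv a c) =
  \sum_(k < n.+1) a ^+ k / qpoch q k * level_sum (n - k) c.
Proof.
elim/ltn_ind: n c => [[|n]] IH c zc.
  by rewrite big_ord1 !level_sum0 expr0 qpoch0 divr1 mul1r.
apply: (@oneBq_mulI n); rewrite level_sumS.
have zcm m : zero_blind (fun u => c (m :: u)) by move=> s1 s2; apply: (zc (m :: s1)).
have conv0 s : conv a c (0%N :: s) = conv a c s.
  by rewrite conv_cons0; apply: eq_conv => u _; apply: (zc [::]).
have step N : (N < n.+1)%N ->
    level_sum N (fun s => conv a c ((n.+1 - N)%N :: s)) =
    a * level_sum N (fun s => conv a c ((n - N)%N :: s)) +
    level_sum N (conv a (fun u => c ((n.+1 - N)%N :: u))).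
  move=> Nn; rewrite -level_sumZ -level_sumD; apply: eq_level_sum => s _.
  by rewrite subSn -1?ltnS // conv_consS.
under eq_bigr => N _ do rewrite step // mulrDr mulrCA.
rewrite big_split /= -mulr_sumr.
(* By [level_sumS] the indices N < n give (1 - q^n) times the right-hand side; N = n restores the
   missing q^n times it, because [conv a c] ignores a leading zero. *)
have -> : \sum_(N < n.+1) q ^+ N * level_sum N (fun s => conv a c ((n - N)%N :: s))
    = level_sum n (conv a c).
  rewrite big_ord_recr /= -(level_sumS n (conv a c)) subnn.
  have -> : level_sum n (fun s => conv a c (0%N :: s)) = level_sum n (conv a c).
    by apply: eq_level_sum => s _; rewrite conv0.
  by rewrite -mulrDl subrK mul1r.
rewrite IH //.
under [X in _ + X]eq_bigr => N _ do rewrite IH // mulr_sumr.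
rewrite (sum_triangle (fun N k => q ^+ N * (a ^+ k / qpoch q k *
  level_sum (N - k) (fun u => c ((n.+1 - N)%N :: u))))).
rewrite mulr_sumr mulr_sumr.
(* The index moves up by one, through (1 - q^k) / (q;q)_k = 1 / (q;q)_(k-1). *)
have -> : \sum_(k < n.+1) a * (a ^+ k / qpoch q k * level_sum (n - k) c) =
  \sum_(k < n.+2) (1 - q ^+ k) * (a ^+ k / qpoch q k * level_sum (n.+1 - k) c).
  rewrite [RHS]big_ord_recl expr0 subrr mul0r add0r; apply: eq_bigr => k _.
  rewrite lift0 subSS qpochS [a ^+ k.+1]exprS; field.
  by rewrite qpoch_neq0 oneBq_neq0.
rewrite [X in X + _]big_ord_recr [RHS]big_ord_recr /= addrAC; congr (_ + _).
rewrite -big_split /=; apply: eq_bigr => k _.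
have kn : (k <= n.+1)%N by apply: ltnW.
(* The split is 1 - q^(n+1) = q^k (1 - q^(n+1-k)) + (1 - q^k); [level_sumS] expands the first
   part. *)
transitivity (a ^+ k / qpoch q k * q ^+ k * ((1 - q ^+ (n.+1 - k)) * level_sum (n.+1 - k) c) +
  (1 - q ^+ k) * (a ^+ k / qpoch q k * level_sum (n.+1 - k) c)).
  rewrite addrC; congr (_ + _); rewrite level_sumS [RHS]mulr_sumr.
  apply: eq_bigr => M _.
  by rewrite addnK exprD subnDA subnAC; ring.
have -> : q ^+ n.+1 = q ^+ (n.+1 - k) * q ^+ k by rewrite -exprD subnK.
ring.
Qed.

(** The value at position [j] of the weakly decreasing sequence with multiplicities [s]. Low levels
    come last, so the head of [s] occupies the final positions. *)
Fixpoint block (s : seq nat) (j : nat) : nat :=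
  match s with
  | [::] => 0
  | m :: s' => if (j < sumn s')%N then (block s' j).+1 else 0
  end.

Definition cuts_at (d : pred nat) (n : nat) (s : seq nat) :=
  [forall i : 'I_n, (0 < i)%N && d i ==> (block s i.-1 != block s i)].

(** The head occupies the positions [N], ..., [N + m - 1]. The sequence drops at [N] anyway, so [d]
    is constrained there only beyond [N]. *)
Lemma cuts_at_cons d N m s : sumn s = N ->
  cuts_at d (N + m) (m :: s) =
  cuts_at d N s && [forall i : 'I_(N + m), (N < i)%N ==> ~~ d i].
Proof.
move=> sN; apply/forallP/andP => [h | [/forallP h1 /forallP h2] i].
  split; apply/forallP => i; apply/implyP.
    case/andP=> i0 di; have iNm : (i < N + m)%N by rewrite ltn_addr.
    have := h (Ordinal iNm); rewrite /= i0 di sN ltn_ord.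
    by rewrite (leq_ltn_trans (leq_pred _) (ltn_ord i)).
  move=> Ni; have := h i; rewrite /= sN [X in X && _](leq_ltn_trans _ Ni) //.
  have -> : (i < N)%N = false by lia.
  have -> : (i.-1 < N)%N = false by lia.
  by case: (d i).
apply/implyP => /andP[i0 di]; rewrite /= sN.
have := h2 i; rewrite di implybF -leqNgt leq_eqVlt => /orP[/eqP eiN | iN].
  by rewrite eiN ltnn; case: ltnP => // ?; lia.
have := h1 (Ordinal iN); rewrite /= i0 di iN.
by have -> : (i.-1 < N)%N by lia.
Qed.

(* The weakly decreasing sequences [s_1 >= ... >= s_n >= 0] that drop strictly
   after each [i] with [d i] have generating function
   [q ^ (sum of the i with d i) / (q; q)_n]. *)
Lemma level_sum_cuts d n :
  level_sum n (fun s => (cuts_at d n s)%:R) =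
  q ^+ (\sum_(1 <= i < n | d i) i) / qpoch q n.
Proof.
pose G n := \sum_(N < n | [forall i : 'I_n, (N < i)%N ==> ~~ d i])
  q ^+ N * level_sum N (fun s => (cuts_at d N s)%:R).
have levelG m : (1 - q ^+ m) * level_sum m (fun s => (cuts_at d m s)%:R) = G m.
  rewrite level_sumS /G [RHS]big_mkcond; apply: eq_bigr => N _ /=.
  have Nm := ltn_ord N.
  transitivity (q ^+ N * ([forall i : 'I_m, (N < i)%N ==> ~~ d i]%:R *
      level_sum N (fun s => (cuts_at d N s)%:R))).
    congr (_ * _); rewrite -level_sumZ; apply: eq_level_sum => s sN.
    by have := cuts_at_cons d (m - N) sN; rewrite subnKC 1?ltnW // => ->;
       rewrite andbC -mulnb natrM.
  by case: ifP => _; rewrite ?mul1r // mul0r mulr0.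
case: n => [|n].
  by rewrite big_geq // qpoch0 divr1 level_sum0; rewrite /cuts_at; case: forallP => // -[] [].
(* [N = m.+1] leaves a last block of one position. For smaller [N] the last position is interior to
   its block, which excludes [d m.+1] and leaves the conditions for one position fewer. *)
have Grec m : G m.+2 = q ^+ m.+1 * level_sum m.+1 (fun s => (cuts_at d m.+1 s)%:R)
    + (if d m.+1 then 0 else G m.+1).
  rewrite /G big_mkcond big_ord_recr /= addrC; congr (_ + _).
    by rewrite (_ : [forall i, _]) //; apply/forallP => i; rewrite ltnNge -ltnS ltn_ord.
  case: ifPn => dm.
    apply: big1 => N _; case: forallP => // /(_ ord_max).
    by rewrite /= dm ltn_ord.
  rewrite [RHS]big_mkcond; apply: eq_bigr => N _; congr (if _ then _ else _).
  apply/forallP/forallP => h i; first exact: (h (widen_ord (leqnSn _) i)).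
  case: (ltnP i m.+1) => im; first exact: (h (Ordinal im)).
  have -> : i = m.+1 :> nat by apply/eqP; rewrite eqn_leq im andbT -ltnS ltn_ord.
  by rewrite dm implybT.
have GE m : G m.+1 = q ^+ (\sum_(1 <= i < m.+1 | d i) i) / qpoch q m.
  elim: m => [|m IHm].
    rewrite /G big_mkcond big_ord1 big_geq // qpoch0 divr1 level_sum0.
    rewrite [cuts_at _ _ _](_ : _ = true); last by apply/forallP => -[].
    rewrite ifT ?mul1r //; apply/forallP => i.
    by rewrite lt0n -leqn0 -ltnS ltn_ord.
  rewrite Grec IHm.
  have -> : level_sum m.+1 (fun s => (cuts_at d m.+1 s)%:R) =
     q ^+ (\sum_(1 <= i < m.+1 | d i) i) / qpoch q m.+1.
    apply: (@oneBq_mulI m); rewrite levelG IHm qpochS; field.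
    by rewrite qpoch_neq0 oneBq_neq0.
  rewrite [in RHS]big_mkcond big_nat_recr //= -big_mkcond /=.
  case: (d m.+1); first by rewrite addr0 exprD; ring.
  rewrite addn0 qpochS; field.
  by rewrite qpoch_neq0 oneBq_neq0.
apply: (@oneBq_mulI n); rewrite levelG GE qpochS; field.
by rewrite qpoch_neq0 oneBq_neq0.
Qed.

End LevelSum.

(** * Classes of the letters of a colored permutation *)

Section Classes.
Variables (l n : nat).
Hypothesis l_gt0 : (0 < l)%N.
Implicit Types (s : {perm 'I_n}) (k : {ffun 'I_n -> 'I_l.+1}).

(* Excedances have class 0, letters of color [a > 0] class [l - a], and the
   other letters of color 0 class [l]. *)
Definition class_of (pi : colperm l n) : {ffun 'I_n -> 'I_l.+1} :=
  [ffun i => if pi.2 i == 0%N :> nat then (if (i < pi.1 i)%N then ord0 else ord_max)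
             else inord (l - pi.2 i)].

Definition class_ok s k :=
  [forall i, ((k i == ord0) ==> (i < s i)%N) && ((k i == ord_max) ==> (s i <= i)%N)].

Lemma class_ofE (pi : colperm l n) i : class_of pi i =
  (if pi.2 i == 0%N :> nat then (if (i < pi.1 i)%N then 0 else l) else l - pi.2 i)%N :> nat.
Proof.
rewrite ffunE; do 2?case: ifP => //= _.
by rewrite inordK // ltnS leq_subr.
Qed.

Lemma class_of_ok pi : class_ok pi.1 (class_of pi).
Proof.
apply/forallP => i; rewrite -!val_eqE /= class_ofE.
have := ltn_ord (pi.2 i); move: (nat_of_ord (pi.2 i)) => e el.
case: (altP (e =P 0%N)) => [_ | e0].
  by case: (ltnP i (pi.1 i)) => h; apply/andP; split; apply/implyP => //; lia.
by apply/andP; split; apply/implyP => /eqP; lia.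
Qed.

(** For fixed [s] the coloring and the class word determine each other: only color 0 splits, into
    the classes 0 and [l], and [s] decides between them. *)
Lemma sum_colperm (V : nmodType) (F : {perm 'I_n} -> {ffun 'I_n -> 'I_l.+1} -> V) :
  \sum_(pi : colperm l n) F pi.1 (class_of pi) =
  \sum_s \sum_(k | class_ok s k) F s k.
Proof.
rewrite -(pair_bigA _ (fun s e => F s (class_of (s, e)))) /=.
apply: eq_bigr => s _.
(* The inverse map: class [l] reaches color 0 by the reduction modulo [l], class 0 by the test. *)
pose color k : {ffun 'I_n -> 'I_l} :=
  [ffun i => Ordinal (ltn_pmod (if k i == ord0 then 0 else l - k i)%N l_gt0)].
rewrite (reindex_onto (fun e => class_of (s, e)) color).
  apply: eq_bigl => e; rewrite (class_of_ok (s, e)); apply/esym/eqP/ffunP => i.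
  rewrite ffunE; apply: val_inj; rewrite /= -val_eqE /= class_ofE /=.
  have := ltn_ord (e i); case: (altP (val (e i) =P 0%N)) => [e0 | e0] el.
    by rewrite (e0 : e i = 0%N :> nat) /=; case: ifP => _; rewrite ?mod0n //;
     case: ifP => _; rewrite ?subn0 ?modnn // subnn mod0n.
  rewrite ifN; last by rewrite subn_eq0 -ltnNge.
  by rewrite subKn ?modn_small // ltnW.
move=> k /forallP ok; apply/ffunP => i; apply: val_inj; rewrite /= class_ofE /= ffunE /=.
have /andP[/implyP k0 /implyP kl] := ok i.
have := ltn_ord (k i); rewrite ltnS leq_eqVlt => /orP[/eqP ki | ki].
  rewrite ki subnn if_same mod0n eqxx ltnNge kl //.
  by apply/eqP; apply: val_inj.
case: (altP (k i =P ord0)) => [kE | kn0]; first by rewrite mod0n /= k0 ?kE.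
have k_gt0 : (0 < k i)%N by rewrite lt0n.
rewrite modn_small; last by rewrite ltn_subrL k_gt0.
rewrite ifN; last by rewrite subn_eq0 -ltnNge.
by rewrite subKn // ltnW.
Qed.

Definition class_desc s k : pred nat := fun i =>
  [exists j : 'I_n, [exists j' : 'I_n, [&& val j == i.-1, val j' == i &
    (k j' < k j)%N || ((k j' == k j) && (s j' < s j)%N)]]].

Definition class_fexc k := (\sum_i (l - k i))%N.
Definition class_fix s k := #|[set i | (k i == ord_max) && (s i == i)]|.

Lemma fexc_class pi : fexc pi = class_fexc (class_of pi).
Proof.
rewrite /fexc /exc -sum1dep_card big_distrr /= big_mkcond -big_split /=.
apply: eq_bigr => i _; rewrite class_ofE; have := ltn_ord (pi.2 i).
move: (nat_of_ord (pi.2 i)) => e el.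
by case: (e =P 0%N) => [->|_] /=; [case: ifP | ] => *; lia.
Qed.

Lemma fixc_class pi : fixc pi = class_fix pi.1 (class_of pi).
Proof.
rewrite /fixc /class_fix; apply: eq_card => i; rewrite !inE -[_ == ord_max]val_eqE /=.
rewrite class_ofE; case: (altP (_ =P i)) => [-> | _]; rewrite ?andbF // !andbT ltnn.
have := ltn_ord (pi.2 i); move: (nat_of_ord (pi.2 i)) => e.
by case: (e =P 0%N); lia.
Qed.

Lemma perm_neq s i j : i != j -> s i != s j.
Proof. by rewrite (inj_eq perm_inj). Qed.

(** Passing to classes moves the excedances from the top of the order to its bottom. This changes
    each descent indicator by the difference of the excedance indicators [x] at the two adjacent
    positions. Weighted by position, these differences telescope to [exc], as the last position is
    never an excedance. *)
Lemma maj_class (pi : colperm l n) :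
  maj pi = (\sum_(1 <= i < n | class_desc pi.1 (class_of pi) i) i + exc pi)%N.
Proof.
pose x i := [exists j : 'I_n, [&& val j == i, val (pi.2 j) == 0%N & (j < pi.1 j)%N]].
set d := class_desc _ _.
have xE (j : 'I_n) : x j = (val (pi.2 j) == 0%N) && (j < pi.1 j)%N.
  apply/existsP/idP => [[j' /and3P[/eqP /val_inj -> -> ->]] // | h].
  by exists j; rewrite eqxx.
have step i : (i.+1 < n)%N -> (is_desc pi i + x i.+1 = d i.+1 + x i)%N.
  move=> ilt; pose j' := Ordinal ilt; pose j := Ordinal (ltnW ilt).
  have -> : is_desc pi i = col_lt (pi.1 j') (pi.2 j') (pi.1 j) (pi.2 j).
    apply/existsP/idP => [[a /existsP[b /and3P[/eqP aE /eqP bE]]] | h].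
      by have -> : a = j by [apply: val_inj]; have -> : b = j' by apply: val_inj.
    by exists j; apply/existsP; exists j'; rewrite !eqxx.
  have -> : d i.+1 = let k := class_of pi in
      (k j' < k j)%N || ((k j' == k j) && (pi.1 j' < pi.1 j)%N).
    apply/existsP/idP => [[a /existsP[b /and3P[/eqP aE /eqP bE]]] | h].
      by have -> : a = j by [apply: val_inj]; have -> : b = j' by apply: val_inj.
    by exists j; apply/existsP; exists j'; rewrite !eqxx.
  rewrite (xE j) (xE j') /= -val_eqE /= !class_ofE /col_lt /=.
  have e1 := ltn_ord (pi.2 j); have e2 := ltn_ord (pi.2 j').
  have : pi.1 j' != pi.1 j by apply: perm_neq; rewrite -val_eqE /=; lia.
  rewrite -val_eqE /=.
  move: (val (pi.1 j)) (val (pi.1 j')) (val (pi.2 j)) (val (pi.2 j')) e1 e2 => a b ea eb.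
  move=> ela elb ba.
  by case: (altP (ea =P 0%N)) => [->|?]; case: (altP (eb =P 0%N)) => [->|?];
     case: (ltnP i a) => ?; case: (ltnP i.+1 b) => ? /=;
     do ?case: ltnP => ? /=; do ?case: eqP => ? /=; lia.
have recr (P : pred nat) f a m : (a <= m)%N -> (\sum_(a <= i < m.+1 | P i) f i =
    \sum_(a <= i < m | P i) f i + (if P m then f m else 0))%N.
  by move=> am; rewrite big_mkcond big_nat_recr //= -big_mkcond.
have tele m : (m < n)%N ->
    (\sum_(0 <= i < m | is_desc pi i) i.+1 + m * x m =
     \sum_(1 <= i < m.+1 | d i) i + \sum_(0 <= i < m) x i)%N.
  elim: m => [|m IH] mn; first by rewrite !big_geq.
  rewrite (recr (is_desc pi)) // (recr d) // (recr xpredT) //=.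
  have := IH (ltnW mn); have := step m mn.
  move: (\sum_(0 <= i < m | _) _)%N (\sum_(1 <= i < m.+1 | _) _)%N => u v.
  move: (\sum_(0 <= i < m) x i)%N => y.
  by case: (is_desc pi m); case: (d m.+1); case: (x m); case: (x m.+1) => /=; lia.
have excE : exc pi = (\sum_(0 <= i < n) x i)%N.
  rewrite /exc -sum1dep_card big_mkord big_mkcond /=.
  by apply: eq_bigr => i _; rewrite xE; case: (_ && _).
rewrite /maj excE.
case: n pi x d xE step tele excE => [|m] pi x d xE _ tele _; first by rewrite !big_geq.
have xm : x m = false.
  by rewrite (xE ord_max) /= ltnNge -ltnS ltn_ord andbF.
have := tele m (ltnSn m); rewrite xm /= muln0 addn0 => ->.
by rewrite [in RHS]big_nat_recr //= xm addn0.
Qed.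
End Classes.

(** * Standardization of words *)

Lemma ltn_pair_encode K x y a b : (a < K)%N -> (b < K)%N ->
  (x * K + a < y * K + b)%N = (x < y)%N || (x == y) && (a < b)%N.
Proof.
move=> aK bK; case: (ltngtP x y) => [xy | yx | ->] /=.
- by have : (x.+1 * K <= y * K)%N; [rewrite leq_mul2r xy orbT | rewrite mulSn; lia].
- by have : (y.+1 * K <= x * K)%N; [rewrite leq_mul2r yx orbT | rewrite mulSn; lia].
- by rewrite ltn_add2l.
Qed.

Lemma eqn_pair_encode K x y a b : (a < K)%N -> (b < K)%N ->
  (x * K + a == y * K + b)%N = (x == y) && (a == b).
Proof.
move=> aK bK; have h1 := ltn_pair_encode x y aK bK; have h2 := ltn_pair_encode y x bK aK.
by lia.
Qed.

Section SortingPerm.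
Variables (n : nat) (f : 'I_n -> nat).
Hypothesis f_inj : injective f.

Fact rank_lt (j : 'I_n) : (#|[set j' | (f j' < f j)%N]| < n)%N.
Proof.
rewrite -[X in (_ < X)%N]card_ord -cardsT; apply: proper_card.
by apply/properP; split; [exact: subsetT | exists j; rewrite // inE ltnn].
Qed.

Definition rank j := Ordinal (rank_lt j).

Lemma rank_inj : injective rank.
Proof.
move=> j j' /(congr1 val) /= e; apply: f_inj; apply/eqP; apply: contraT.
rewrite neq_ltn => /orP[] h; suff : false by []; move: e; apply: contra_eqT => _;
  rewrite neq_ltn; apply/orP; [left | right]; apply: proper_card; apply/properP; split.
- by apply/subsetP => i; rewrite !inE => /ltn_trans; apply.
- by exists j; rewrite inE // ltnn.
- by apply/subsetP => i; rewrite !inE => /ltn_trans; apply.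
- by exists j'; rewrite inE // ltnn.
Qed.

Definition sorting_perm : {perm 'I_n} := ((perm rank_inj)^-1)%g.

Lemma card_ltn_ord (i : 'I_n) : #|[set i' : 'I_n | (i' < i)%N]| = i.
Proof.
by rewrite -sum1dep_card -(big_ord_widen n (fun=> 1%N)) ?sum1_card ?card_ord // ltnW.
Qed.

(** If [f] increases along [s], exactly the letters [s i'] with [i' < i] have a smaller key than
    [s i], so [s i] has rank [i]. *)
Lemma sorting_permP (s : {perm 'I_n}) :
  (forall i i' : 'I_n, (i < i')%N -> (f (s i) < f (s i'))%N) <->
  s = sorting_perm.
Proof.
split=> [mono | -> i i' ii'].
  have ltE i i' : (f (s i) < f (s i'))%N = (i < i')%N.
    case: (ltngtP i i') => [/mono // | /mono h | /val_inj ->]; last exact: ltnn.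
    by apply/negbTE; rewrite -leqNgt ltnW.
  apply/permP => i; rewrite /sorting_perm; apply: (@perm_inj _ (perm rank_inj)).
  rewrite permKV permE; apply: val_inj => /=.
  rewrite -[RHS]card_ltn_ord -[RHS](card_imset _ (@perm_inj _ s)); apply: eq_card => j.
  rewrite inE -[j](permKV s) ltE; apply/idP/imsetP => [h | [i1]].
    by exists ((s^-1)%g j); rewrite ?inE.
  by rewrite inE => h /perm_inj ->.
have rankE j : rank (sorting_perm j) = j.
  by rewrite /sorting_perm -[LHS](permE rank_inj) permKV.
rewrite ltnNge; apply/negP => le_f.
suff : (rank (sorting_perm i') <= rank (sorting_perm i))%N.
  by rewrite !rankE leqNgt ii'.
by apply: subset_leq_card; apply/subsetP => j; rewrite !inE => /leq_trans; apply.
Qed.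
End SortingPerm.

Lemma antitone_eq n (f g : 'I_n -> nat) :
  (forall i j : 'I_n, (i <= j)%N -> (f j <= f i)%N) ->
  (forall i j : 'I_n, (i <= j)%N -> (g j <= g i)%N) ->
  (forall v, #|[set i | f i == v]| = #|[set i | g i == v]|) -> f =1 g.
Proof.
move=> anti_f anti_g fg.
have sortedE h : (forall i j : 'I_n, (i <= j)%N -> (h j <= h i)%N) ->
    sorted geq (map h (enum 'I_n)).
  move=> anti_h; rewrite sorted_map.
  apply: (@sub_sorted _ (relpre val leq)) => [i j /= /anti_h //|].
  by rewrite -sorted_map val_enum_ord iota_sorted.
have countE h v : count_mem v (map h (enum 'I_n)) = #|[set i | h i == v]|.
  by rewrite count_map -sum1_count big_enum_cond -sum1dep_card.
suff /eq_in_map e : map f (enum 'I_n) = map g (enum 'I_n).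
  by move=> i; apply: e; rewrite mem_enum.
apply: (@sorted_eq _ geq); [| | exact: sortedE | exact: sortedE |].
- by move=> x y z /= h1 h2; apply: leq_trans h2 h1.
- by move=> x y; rewrite andbC => /anti_leq.
by apply/allP => v _ /=; rewrite !countE fg.
Qed.

(* [bi j] is the block containing position [j], while the letter with value [j]
   of a permutation stands in the block [B j] and has class [C j]. *)
Section Standardization.
Variables (n l : nat) (bi : nat -> nat) (B C : 'I_n -> nat).
Hypothesis bi_anti : forall i j : nat, (i <= j)%N -> (bi j <= bi i)%N.

(** The order in which the letters stand in the permutation: block numbers decrease along positions,
    so a larger [B] comes first. *)
Definition letter_lt (j j' : 'I_n) : bool :=
  (B j' < B j)%N || (B j == B j') && ((C j < C j')%N || (C j == C j') && (j < j')%N).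

Definition first_in_block j := (j == 0%N) || (bi j.-1 != bi j).

(** A form, using blocks alone, of the requirement that the letter [j] stands before position [j] if
    its class is 0, and not before it if its class is [l]. Third clause: if [j] is the first
    position of the block holding the letter [j], no earlier position is left there. *)
Definition letter_ok (j : 'I_n) :=
  [&& (C j == 0%N) ==> (bi j <= B j)%N, (C j == l) ==> (B j <= bi j)%N
    & first_in_block j ==> ~~ ((B j == bi j) && (C j == 0%N))].

Definition fixed_tail (j : 'I_n) := [forall j' : 'I_n,
  (j <= j')%N && (bi j' == bi j) ==> (B j' == bi j) && (C j' == l)].

Variable s : {perm 'I_n}.
Hypothesis Bs : forall i, B (s i) = bi i.

Lemma monotone_of_cuts :
  (forall i i' : 'I_n, i' = i.+1 :> nat -> bi i = bi i' ->
     ~~ ((C (s i') < C (s i))%N || ((C (s i') == C (s i)) && (s i' < s i)%N))) <->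
  (forall i i' : 'I_n, (i < i')%N -> letter_lt (s i) (s i')).
Proof.
split=> [cuts | mono i i' ii' bii'].
  have lt_trans (a b c : 'I_n) : letter_lt a b -> letter_lt b c -> letter_lt a c.
    by rewrite /letter_lt; lia.
  move=> i i'; elim: {i'}(nat_of_ord i') {-2}i' (erefl (nat_of_ord i')) => [|m IH] i' i'm im.
    by rewrite i'm in im.
  have mn : (m < n)%N by have := ltn_ord i'; lia.
  have lt_m : letter_lt (s (Ordinal mn)) (s i').
    have := cuts (Ordinal mn) i' i'm; have := @bi_anti m i'; rewrite /letter_lt !Bs /=.
    rewrite i'm => /(_ (leqnSn _)); rewrite leq_eqVlt -i'm => /orP[/eqP <- | ->] //.
    move=> /(_ erefl); rewrite ltnn eqxx /= negb_or -leqNgt leq_eqVlt.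
    case/andP => /orP[/eqP -> | -> //]; rewrite ltnn eqxx /= -leqNgt leq_eqVlt.
    case/orP=> [/eqP /val_inj /perm_inj /(congr1 val) /= | //].
    by rewrite i'm => /n_Sn.
  move: im; rewrite i'm ltnS leq_eqVlt => /orP[/eqP im | im].
    by have <- : Ordinal mn = i by apply: val_inj.
  exact: lt_trans (IH (Ordinal mn) _ im) lt_m.
have := mono i i'; rewrite ii' ltnSn => /(_ isT); rewrite /letter_lt !Bs bii'; lia.
Qed.

Hypothesis s_mono : forall i i' : 'I_n, (i < i')%N -> letter_lt (s i) (s i').

Lemma same_block_mono (i i' : 'I_n) : (i < i')%N -> bi i = bi i' ->
  (C (s i) <= C (s i'))%N /\ (C (s i) = C (s i') -> (s i < s i')%N).
Proof.
move=> /s_mono; rewrite /letter_lt !Bs => + e; rewrite e; lia.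
Qed.

Hypothesis C_le : forall j, (C j <= l)%N.

(** Within a block classes increase weakly and letters of equal class increase. Hence the excedance
    property propagates from the start of a block through its class 0 letters, and [s i <= i]
    propagates backwards from its end through its class [l] letters. At the ends of the block
    [letter_ok] suffices. *)
Lemma letters_okP :
  (forall i, (C (s i) = 0%N -> (i < s i)%N) /\ (C (s i) = l -> (s i <= i)%N)) <->
  (forall j, letter_ok j).
Proof.
split=> [ok j | ok i].
  have := ok ((s^-1)%g j); set i := (s^-1)%g j; rewrite permKV => -[ok0 okl].
  have Bj : B j = bi i by rewrite -Bs permKV.
  apply/and3P; split; apply/implyP; rewrite Bj.
  - by move/eqP=> /ok0 ij; apply/bi_anti/ltnW.
  - by move/eqP=> /okl; apply: bi_anti.
  - move=> fj; apply/negP => /andP[/eqP e /eqP /ok0 ij].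
    case/orP: fj => [/eqP j0 | /negP[]]; first by rewrite j0 in ij.
    rewrite eqn_leq -{1}e !bi_anti ?leq_pred //.
    by rewrite -ltnS (ltn_predK ij).
split.
  elim: {i}(nat_of_ord i) {-2}i (erefl (nat_of_ord i)) => [|m IH] i im ci.
    have /and3P[/implyP h1 _ /implyP h2] := ok (s i).
    rewrite im lt0n; apply/eqP => si0.
    have e : s i = i by apply: ord_inj; apply: etrans si0 (esym im).
    have Bi : B i = bi i by rewrite -[in LHS]e Bs.
    by move: h2; rewrite ci e Bi /first_in_block im !eqxx => /(_ isT).
  have /and3P[/implyP + _ /implyP h2] := ok (s i).
  rewrite ci eqxx Bs => /(_ isT) h1; rewrite ltnNge; apply/negP => le_si.
  have e1 : bi (s i) = bi i by apply/eqP; rewrite eqn_leq h1 bi_anti.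
  have mn : (m < n)%N by have := ltn_ord i; lia.
  pose i' := Ordinal mn.
  case: (boolP (bi m == bi i)) => [/eqP e2 | ne2].
    have i'i : (i' < i)%N by rewrite im.
    have [c1 c2] := same_block_mono i'i e2.
    have ci' : C (s i') = 0%N by apply/eqP; rewrite -leqn0 -ci.
    have := IH i' erefl ci'; have := c2; rewrite ci' ci => /(_ erefl).
    by rewrite /=; lia.
  have si : s i = i.
    apply: val_inj; apply/eqP; rewrite eqn_leq le_si /= leqNgt; apply/negP => lt_si.
    case/negP: ne2; rewrite eqn_leq -{1}e1 !bi_anti //; lia.
  have Bi : B i = bi i by rewrite -[in LHS]si Bs.
  by move: h2; rewrite ci si Bi /first_in_block im /= -im ne2 !eqxx => /(_ isT).
move: {2}(n - i)%N (erefl (n - i)%N) => d.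
elim: d i => [|d IH] i dE ci; first by have := ltn_ord i; lia.
have /and3P[_ /implyP + _] := ok (s i).
rewrite ci eqxx Bs => /(_ isT) h1; rewrite leqNgt; apply/negP => lt_si.
have iSn : (i.+1 < n)%N by apply: leq_ltn_trans (ltn_ord (s i)).
pose i' := Ordinal iSn.
have ii' : (i < i')%N by rewrite /=.
have e1 : bi i = bi i'.
  apply/eqP; rewrite eqn_leq (bi_anti (ltnW ii')) andbT.
  by apply: leq_trans h1 _; apply: bi_anti.
have [c1 c2] := same_block_mono ii' e1.
have ci' : C (s i') = l by apply/eqP; rewrite eqn_leq C_le -ci.
have := IH i' _ ci'; have := c2; rewrite ci' ci => /(_ erefl).
by rewrite /=; lia.
Qed.

(** After a fixed point of class [l], the rest of its block has class [l] and letters squeezed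
    between [s j >= j] and [s j <= j]. Conversely, working back from the end of the block, each
    letter [j] of the tail stands at or after [j], and the later positions are already taken. *)
Lemma fixed_tailP (i : 'I_n) :
  (forall j, letter_ok j) -> (C (s i) == l) && (s i == i) = fixed_tail i.
Proof.
move=> /letters_okP ok; apply/andP/forallP => [[/eqP ci /eqP si] j | h].
  apply/implyP => /andP[ij /eqP e].
  suff sj : s j = j /\ C (s j) = l.
    by case: sj => sj cj; rewrite -e -{1 3}sj Bs cj !eqxx.
  elim: {j}(nat_of_ord j) {-2}j (erefl (nat_of_ord j)) ij e => [|m IH] j jm ij e.
    by have <- : i = j by apply: ord_inj; lia.
  move: ij; rewrite leq_eqVlt => /orP[/eqP /val_inj <- // | ij].
  have mn : (m < n)%N by have := ltn_ord j; lia.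
  pose m' := Ordinal mn; have im : (i <= m)%N by rewrite -ltnS -jm.
  have em : bi m = bi i by apply/eqP; rewrite eqn_leq bi_anti //= -e bi_anti //; lia.
  have mj : (m' < j)%N by rewrite jm.
  have [sm cm] := IH m' erefl im em.
  have [c1 c2] := same_block_mono mj (etrans em (esym e)).
  have cj : C (s j) = l by apply/eqP; rewrite eqn_leq C_le -cm.
  split=> //; apply: val_inj; apply/eqP; rewrite eqn_leq (proj2 (ok j)) //=.
  by have := c2 (etrans cm (esym cj)); rewrite sm jm.
suff fixed d (j : 'I_n) : (n - j <= d)%N -> (i <= j)%N -> bi j = bi i -> s j = j.
  have /andP[_ /eqP ci] := implyP (h i) (introT andP (conj (leqnn i) (eqxx _))).
  by rewrite (fixed _ i (leqnn _)) // ci !eqxx.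
elim: d j => [|d IH] j dE ij e; first by have := ltn_ord j; lia.
have [i' si'] : exists i', s i' = j by exists ((s^-1)%g j); rewrite permKV.
have /andP[/eqP Bj /eqP Cj] : (B j == bi i) && (C j == l).
  by apply: (implyP (h j)); rewrite ij e eqxx.
have ji' : (j <= i')%N by rewrite -[X in (X <= _)%N]/(val j) -si' (proj2 (ok i')) // si'.
move: ji'; rewrite leq_eqVlt => /orP[/eqP /ord_inj ji' | ji'].
  by rewrite {1}ji'.
have fi' : s i' = i'.
  apply: IH; [by have := ltn_ord i'; lia | exact: leq_trans ij (ltnW ji') |].
  by rewrite -Bs si' Bj.
by move: ji'; rewrite -[X in (_ < X)%N]/(val i') -fi' si' ltnn.
Qed.
End Standardization.

Lemma block_anti u i j : (i <= j)%N -> (block u j <= block u i)%N.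
Proof.
elim: u i j => //= m u IH i j ij; case: (ltnP j (sumn u)) => // ju.
by rewrite (leq_ltn_trans ij ju) ltnS IH.
Qed.

Lemma block_lt u i : (i < sumn u)%N -> (block u i < size u)%N.
Proof. by elim: u => //= m u IH _; case: ifP => // /IH. Qed.

Lemma card_block u v :
  #|[set i : 'I_(sumn u) | block u i == v]| = nth 0%N u v.
Proof.
rewrite -sum1dep_card -(big_mkord (fun i => block u i == v) (fun=> 1%N)) /=.
elim: u v => [|m u IH] v /=; first by rewrite big_geq // nth_nil.
rewrite addnC (big_cat_nat (n := sumn u)) //= ?leq_addr //.
have -> : (\sum_(sumn u <= i < sumn u + m |
     (if (i < sumn u)%N then (block u i).+1 else 0%N) == v) 1 = (v == 0%N) * m)%N.
  rewrite big_mkcond /= (eq_big_nat _ _ (F2 := fun=> nat_of_bool (v == 0%N))).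
    by rewrite sum_nat_const_nat addnC addnK mulnC.
  by move=> i /andP[ui _]; rewrite ltnNge ui /= eq_sym; case: eqP.
have -> : (\sum_(0 <= i < sumn u |
     (if (i < sumn u)%N then (block u i).+1 else 0%N) == v) 1 =
   \sum_(0 <= i < sumn u | (block u i).+1 == v) 1)%N.
  rewrite big_mkcond [RHS]big_mkcond; apply: eq_big_nat => i /andP[_ ->] //.
case: v => [|v]; first by rewrite big1 // mul1n.
by rewrite mul0n addn0 /= -IH; apply: eq_bigl.
Qed.

(** * Colored permutations as stable sortings of words *)

Definition class_weight (K : comNzRingType) l n (t r : K) (s : {perm 'I_n})
    (k : {ffun 'I_n -> 'I_l.+1}) :=
  t ^+ class_fexc k * r ^+ class_fix s k.

Section PermutationsToWords.
Variables (K : comNzRingType) (l : nat) (t r : K) (u : seq nat).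
Let N := size u.
Let n := sumn u.
Implicit Types (s : {perm 'I_n}) (k : {ffun 'I_n -> 'I_l.+1}).
Implicit Types (w : {ffun 'I_n -> 'I_N * 'I_l.+1}).

Let B w (j : 'I_n) : nat := (w j).1.
Let C w (j : 'I_n) : nat := (w j).2.

Definition word_ok w := [forall j, letter_ok l (block u) (B w) (C w) j].
Definition has_content w := [forall v : 'I_N, #|[set j | (w j).1 == v]| == nth 0%N u v].

Let key w (j : 'I_n) := ((((N - B w j) * l.+1 + C w j) * n) + j)%N.

Lemma key_ltE w j j' : (key w j < key w j')%N = letter_lt (B w) (C w) j j'.
Proof.
have C_lt i : (C w i < l.+1)%N by apply: ltn_ord.
have B_lt i : (B w i < N)%N by apply: ltn_ord.
rewrite /key !(ltn_pair_encode, eqn_pair_encode) ?C_lt // /letter_lt.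
by have := B_lt j; have := B_lt j'; lia.
Qed.

Lemma key_inj w : injective (key w).
Proof.
move=> j j' e; have h1 := key_ltE w j j'; have h2 := key_ltE w j' j.
rewrite e ltnn /letter_lt in h1; rewrite e ltnn /letter_lt in h2.
by apply: ord_inj; lia.
Qed.

Definition class_word s w : {ffun 'I_n -> 'I_l.+1} := [ffun i => (w (s i)).2].

Definition standardizes s w := [&& [forall i, B w (s i) == block u i],
  class_ok s (class_word s w) & cuts_at (class_desc s (class_word s w)) n u].

Lemma cuts_class_desc s w :
  cuts_at (class_desc s (class_word s w)) n u <->
  (forall i i' : 'I_n, i' = i.+1 :> nat -> block u i = block u i' ->
     ~~ ((C w (s i') < C w (s i))%N ||
         ((C w (s i') == C w (s i)) && (s i' < s i)%N))).
Proof.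
split=> [/forallP cuts i i' ii' bii' | cuts].
  apply/negP => d; have := cuts i'; rewrite ii' /= bii' ii' eqxx /= implybF => /negP[].
  apply/existsP; exists i; apply/existsP; exists i'.
  by rewrite /= ii' !eqxx /= -val_eqE /= !ffunE.
apply/forallP => i'; apply/implyP => /andP[i'0 /existsP[j /existsP[j' /and3P[]]]].
move=> /eqP jE /eqP /val_inj -> d; apply/negP => /eqP e.
have := cuts j i'; rewrite [val j]jE prednK // => /(_ erefl e) /negP[].
by move: d; rewrite -val_eqE /= !ffunE.
Qed.

Lemma class_ok_word s w : class_ok s (class_word s w) <->
  (forall i, (C w (s i) = 0%N -> (i < s i)%N) /\ (C w (s i) = l -> (s i <= i)%N)).
Proof.
split=> [/forallP ok i | ok].
  have := ok i; rewrite -!val_eqE /= ffunE => /andP[/implyP h1 /implyP h2].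
  by split=> e; [apply: h1 | apply: h2]; apply/eqP.
apply/forallP => i; rewrite -!val_eqE /= ffunE; have [h1 h2] := ok i.
by apply/andP; split; apply/implyP => /eqP.
Qed.

(** Sorting puts the blocks in decreasing order, so the content alone forces position [i] to lie in
    [block u i]. A word thus comes from at most one permutation. *)
Lemma standardizesP s w :
  standardizes s w =
  [&& has_content w, word_ok w & s == sorting_perm (@key_inj w)].
Proof.
have anti i j := @block_anti u i j.
have C_le j : (C w j <= l)%N by rewrite -ltnS; apply: ltn_ord.
apply/and3P/and3P => [[/forallP bs ok cuts] | [/forallP cont ok /eqP sE]].
  have Bs i : B w (s i) = block u i by apply/eqP.
  have mono := (monotone_of_cuts (C w) anti Bs).1 ((cuts_class_desc s w).1 cuts).
  split.
  - apply/forallP => v; rewrite -card_block -[X in _ == X](card_imset _ (@perm_inj _ s)).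
    apply/eqP/eq_card => j; rewrite inE -val_eqE; apply/eqP/imsetP => [e | [i + ->]].
      by exists ((s^-1)%g j); rewrite ?permKV // inE -Bs permKV; apply/eqP.
    by rewrite inE -Bs => /eqP.
  - by apply/forallP/(letters_okP anti Bs mono C_le)/class_ok_word.
  - by apply/eqP/sorting_permP => i i' /mono; rewrite key_ltE.
have mono (i i' : 'I_n) : (i < i')%N -> letter_lt (B w) (C w) (s i) (s i').
  by move=> ii'; rewrite -key_ltE; apply: ((sorting_permP (@key_inj w) s).2 sE).
have Bs i : B w (s i) = block u i.
  apply: (antitone_eq (f := fun i => B w (s i)) (g := fun i => block u (val i))).
  - move=> {}i j; rewrite leq_eqVlt => /orP[/eqP /ord_inj -> // | /mono].
    by rewrite /letter_lt; lia.
  - by move=> {}i j; apply: anti.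
  - move=> v; rewrite card_block -[LHS](card_imset _ (@perm_inj _ s)).
    transitivity #|[set j | B w j == v]|.
      apply: eq_card => j; rewrite inE; apply/imsetP/idP => [[i1 + ->] | e].
        by rewrite inE.
      by exists ((s^-1)%g j); rewrite ?permKV // inE permKV.
    case: (ltnP v N) => vN; first by rewrite -(eqP (cont (Ordinal vN))).
    rewrite nth_default //; apply/eqP; rewrite cards_eq0; apply/eqP/setP => j.
    rewrite !inE; apply/negbTE; rewrite neq_ltn; apply/orP; left.
    exact: leq_trans (ltn_ord _) vN.
split.
- by apply/forallP => i; rewrite Bs.
- by apply/class_ok_word/(letters_okP anti Bs mono C_le)/forallP.
- by apply/cuts_class_desc/(monotone_of_cuts (C w) anti Bs).
Qed.

Definition word_weight w := t ^+ (\sum_j (l - C w j)) *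
  r ^+ #|[set j | fixed_tail l (block u) (B w) (C w) j]|.

Lemma class_weight_word s w :
  standardizes s w -> class_weight t r s (class_word s w) = word_weight w.
Proof.
move=> std; have := std; rewrite standardizesP => /and3P[_ /forallP ok _].
case/and3P: std => /forallP bs _ cuts.
have anti i j := @block_anti u i j.
have C_le j : (C w j <= l)%N by rewrite -ltnS; apply: ltn_ord.
have Bs i : B w (s i) = block u i by apply/eqP.
have mono := (monotone_of_cuts (C w) anti Bs).1 ((cuts_class_desc s w).1 cuts).
congr (_ ^+ _ * _ ^+ _).
  rewrite [RHS](reindex_inj (@perm_inj _ s)).
  by apply: eq_bigr => i _; rewrite ffunE.
apply: eq_card => i; rewrite !inE -(fixed_tailP anti Bs mono C_le i ok).
by rewrite -val_eqE /= ffunE.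
Qed.

(** Double counting of the pairs in [standardizes]: for fixed [s] the word is given by the classes,
    its blocks being prescribed; for a fixed word [s] is its sorting permutation. *)
Lemma sum_class_words :
  \sum_(s : {perm 'I_n}) \sum_(k : {ffun 'I_n -> 'I_l.+1} | class_ok s k)
     (cuts_at (class_desc s k) n u)%:R * class_weight t r s k =
  \sum_(w | has_content w && word_ok w) word_weight w.
Proof.
transitivity (\sum_s \sum_(w | standardizes s w) word_weight w); last first.
  rewrite (exchange_big_dep predT) //= [RHS]big_mkcond; apply: eq_bigr => w _.
  rewrite (eq_bigl (fun s => (has_content w && word_ok w) &&
    (s == sorting_perm (@key_inj w)))); last by move=> s; rewrite standardizesP andbA.
  case: ifP => _; last by rewrite big_pred0.
  by rewrite big_pred1_eq.
apply: eq_bigr => s _.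
pose blk (i : 'I_n) : 'I_N := Ordinal (block_lt (ltn_ord i)).
pose of_class k : {ffun 'I_n -> 'I_N * 'I_l.+1} :=
  [ffun j => (blk ((s^-1)%g j), k ((s^-1)%g j))].
have classK k : class_word s (of_class k) = k.
  by apply/ffunP => i; rewrite !ffunE /= permK.
rewrite [RHS](reindex_onto of_class (class_word s)) => [|w /and3P[/forallP bs _ _]].
  rewrite [LHS]big_mkcond [RHS]big_mkcond; apply: eq_bigr => k _.
  rewrite classK eqxx andbT /=.
  case: (boolP (standardizes s (of_class k))) => [std | nstd].
    rewrite -(class_weight_word std) classK.
    by case/and3P: std => _; rewrite classK => -> ->; rewrite mul1r.
  have blkE : [forall i, B (of_class k) (s i) == block u i].
    by apply/forallP => i; rewrite /B ffunE /= permK.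
  move: nstd; rewrite /standardizes blkE classK /=.
  by case: (class_ok s k) => //= /negbTE ->; rewrite mul0r.
apply/ffunP => j; rewrite !ffunE permKV [RHS]surjective_pairing; congr (_, _).
apply: ord_inj => /=.
by have /eqP := bs ((s^-1)%g j); rewrite permKV.
Qed.

End PermutationsToWords.

(** * Words as sequences of blocks *)

Section WordSums.
Variables (V : nzSemiRingType) (T : finType).

(** Words are lists here, so that a sum over words splits along a concatenation of blocks. *)
Fixpoint wsum n (G : seq T -> V) : V :=
  if n is n'.+1 then \sum_x wsum n' (fun z => G (x :: z)) else G [::].

Lemma eq_wsum n G G' : (forall z, size z = n -> G z = G' z) -> wsum n G = wsum n G'.
Proof.
elim: n G G' => [|n IH] G G' e /=; first exact: e.
by apply: eq_bigr => x _; apply: IH => z zn; apply: e; rewrite /= zn.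
Qed.

Lemma wsum_cat a b G : wsum (a + b) G = wsum a (fun z => wsum b (fun z' => G (z ++ z'))).
Proof.
elim: a G => [|a IH] G //=.
by apply: eq_bigr => x _; rewrite IH.
Qed.

Lemma wsum_rcons n G : wsum n.+1 G = \sum_x wsum n (fun z => G (rcons z x)).
Proof.
elim: n G => [|n IH] G //.
transitivity (\sum_x \sum_x' wsum n (fun z => G (x :: rcons z x'))).
  by apply: eq_bigr => x _; apply: (IH (fun z => G (x :: z))).
by rewrite exchange_big.
Qed.

Lemma wsum_mull n a G : wsum n (fun z => a * G z) = a * wsum n G.
Proof.
elim: n G => [|n IH] G //=; rewrite mulr_sumr.
by apply: eq_bigr => x _; rewrite IH.
Qed.

Lemma wsum_mulr n a G : wsum n (fun z => G z * a) = wsum n G * a.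
Proof.
elim: n G => [|n IH] G //=; rewrite mulr_suml.
by apply: eq_bigr => x _; rewrite IH.
Qed.

Lemma sum_ffun_wsum n (G : seq T -> V) :
  \sum_(w : {ffun 'I_n -> T}) G [seq w i | i <- enum 'I_n] = wsum n G.
Proof.
elim: n G => [|n IH] G /=.
  rewrite (big_pred1 [ffun i : 'I_0 => match notF (ltn_ord i) with end]).
    by rewrite enum_ord0.
  by move=> w; apply/esym/eqP/ffunP => -[].
pose cons_fun (p : T * {ffun 'I_n -> T}) : {ffun 'I_n.+1 -> T} :=
  [ffun i => oapp p.2 p.1 (unlift ord0 i)].
pose uncons (w : {ffun 'I_n.+1 -> T}) := (w ord0, [ffun i => w (lift ord0 i)]).
have consK : cancel cons_fun uncons.
  move=> [x w]; congr (_, _); first by rewrite ffunE unlift_none.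
  by apply/ffunP => i; rewrite !ffunE liftK.
have unconsK : cancel uncons cons_fun.
  move=> w; apply/ffunP => i; rewrite ffunE.
  by case: (unliftP ord0 i) => [j|] -> /=; rewrite ?ffunE.
rewrite (reindex cons_fun) /=; last by exists uncons => ? _.
rewrite -(pair_bigA _ (fun x w => G [seq cons_fun (x, w) i | i <- enum 'I_n.+1])) /=.
apply: eq_bigr => x _; rewrite -IH; apply: eq_bigr => w _; congr G.
rewrite enum_ordSl /= ffunE unlift_none /= -map_comp; congr (_ :: _).
by apply: eq_map => i /=; rewrite ffunE liftK.
Qed.
End WordSums.

(** * Weights of a single block *)

Section BlockWeights.
Variables (P : comNzRingType) (N l : nat) (t r : P) (y : 'I_N -> P).
Hypothesis l_gt0 : (0 < l)%N.
Variable x0 : 'I_N * 'I_l.+1.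
Implicit Types (x : 'I_N * 'I_l.+1) (z : seq ('I_N * 'I_l.+1)).

Definition letter_allowed h (first : bool) x :=
  [&& (x.2 == 0%N :> nat) ==> (h <= x.1)%N, (x.2 == l :> nat) ==> (x.1 <= h)%N
    & first ==> ~~ ((x.1 == h :> nat) && (x.2 == 0%N :> nat))].

Definition letter_weight h first x : P :=
  if letter_allowed h first x then t ^+ (l - x.2) * y x.1 else 0.

Definition fixed_letter h x := (x.1 == h :> nat) && (x.2 == l :> nat).

Definition tail_length h z := find (predC (fixed_letter h)) (rev z).

Definition pure_weight h z :=
  \prod_(0 <= i < size z) letter_weight h (i == 0%N) (nth x0 z i).

Definition block_weight h z := pure_weight h z * r ^+ tail_length h z.

Lemma tail_length_rcons h z x : tail_length h (rcons z x) =
  if fixed_letter h x then (tail_length h z).+1 else 0%N.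
Proof. by rewrite /tail_length rev_rcons /=; case: fixed_letter. Qed.

Lemma pure_weight_rcons h z x :
  pure_weight h (rcons z x) = pure_weight h z * letter_weight h (size z == 0%N) x.
Proof.
rewrite /pure_weight size_rcons big_nat_recr //= nth_rcons ltnn eqxx; congr (_ * _).
by apply: eq_big_nat => i /andP[_ iz]; rewrite nth_rcons iz.
Qed.

(** The suffixes made of fixed letters are those inside the maximal such tail, one for each of its
    letters. *)
Lemma tail_length_sum h z :
  (\sum_(0 <= i < size z) all (fixed_letter h) (drop i z))%N = tail_length h z.
Proof.
elim/last_ind: z => [|z x IH]; first by rewrite big_geq.
rewrite size_rcons big_nat_recr //= tail_length_rcons -IH.
rewrite (eq_big_nat _ _ (F2 := fun i =>
   (fixed_letter h x && all (fixed_letter h) (drop i z) : nat))); last first.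
  by move=> i /andP[_ /ltnW iz]; rewrite drop_rcons // all_rcons.
rewrite drop_rcons // drop_size /= andbT; case: (fixed_letter h x) => /=.
  by rewrite addn1.
by rewrite addn0 big1.
Qed.

Definition tail_at h u z j := [forall j' : 'I_(sumn u),
  (j <= j')%N && (block u j' == block u j) ==>
    fixed_letter (h + block u j) (nth x0 z j')].

(** The offset [h] is the number of blocks already removed from the head of the list, and lets the
    induction keep absolute block numbers. *)
Definition seq_weight h u z :=
  (\prod_(0 <= j < sumn u) letter_weight (h + block u j)
      (first_in_block (block u) j) (nth x0 z j)) *
  r ^+ (\sum_(0 <= j < sumn u) tail_at h u z j).

Lemma seq_weight_cons h m u z z' : size z = sumn u -> size z' = m ->
  seq_weight h (m :: u) (z ++ z') = seq_weight h.+1 u z * block_weight h z'.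
Proof.
move=> zu z'm; rewrite /seq_weight /block_weight.
have -> : sumn (m :: u) = (sumn u + m)%N by rewrite addnC.
have blk_in j : (j < sumn u)%N -> block (m :: u) j = (block u j).+1 by move=> /= ->.
have blk_out j : (sumn u <= j)%N -> block (m :: u) j = 0%N.
  by move=> /= uj; rewrite ltnNge uj.
have tail_in j : (j < sumn u)%N -> tail_at h (m :: u) (z ++ z') j = tail_at h.+1 u z j.
  move=> ju; apply/forallP/forallP => tl j'; apply/implyP => /andP[jj' e].
    have j'u : (j' < m + sumn u)%N by rewrite ltn_addl.
    have := tl (Ordinal j'u); rewrite -[nat_of_ord (Ordinal _)]/(nat_of_ord j').
    by rewrite jj' (blk_in j) // (blk_in j') // eqSS e /= nth_cat zu ltn_ord addSnnS.
  have j'u : (j' < sumn u)%N.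
    by rewrite ltnNge; apply/negP => uj'; rewrite (blk_in j) // (blk_out j') in e.
  rewrite (blk_in j) // (blk_in j') // eqSS in e.
  have := tl (Ordinal j'u); rewrite -[nat_of_ord (Ordinal _)]/(nat_of_ord j').
  by rewrite jj' e (blk_in j) // nth_cat zu j'u addSnnS.
have tail_out i : (i < m)%N ->
    tail_at h (m :: u) (z ++ z') (sumn u + i) = all (fixed_letter h) (drop i z').
  move=> im; rewrite /tail_at (blk_out (_ + _)%N) ?leq_addr // addn0.
  apply/forallP/(all_nthP x0) => [tl a | tl j'].
    rewrite size_drop z'm nth_drop => am.
    have lt_u : (sumn u + (i + a) < m + sumn u)%N by lia.
    have := tl (Ordinal lt_u); rewrite -[nat_of_ord (Ordinal _)]/(sumn u + (i + a))%N.
    rewrite blk_out ?leq_addr // nth_cat zu addKn eqxx andbT addnA leq_addr /=.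
    by have -> : (sumn u + i + a < sumn u)%N = false by lia.
  apply/implyP => /andP[ij' _]; rewrite nth_cat zu.
  have -> : (j' < sumn u)%N = false by lia.
  have j'_lt : (j' < m + sumn u)%N by apply: ltn_ord.
  have := tl (j' - sumn u - i)%N; rewrite size_drop nth_drop z'm subnKC; last by lia.
  by apply; lia.
rewrite mulrACA -exprD; congr (_ * _ ^+ _).
  rewrite (big_cat_nat (n := sumn u)) ?leq_addr //=; congr (_ * _).
    apply: eq_big_nat => j /andP[_ ju]; rewrite nth_cat zu ju -addSnnS; congr letter_weight.
    by case: j ju => // j ju; rewrite /first_in_block /= ju (ltnW ju) eqSS.
  rewrite -{1}[sumn u]add0n big_addn addKn /pure_weight z'm.
  apply: eq_big_nat => i /andP[_ im]; rewrite nth_cat zu.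
  have -> : (i + sumn u < sumn u)%N = false by lia.
  rewrite addnK addn0; congr letter_weight.
  rewrite /first_in_block; case: i im => [|i] im /=.
    case: (sumn u) => // k; rewrite ltnn /=.
    by have -> : (k < k.+1)%N.
  have -> : (i + sumn u < sumn u)%N = false by lia.
  by have -> : (i.+1 + sumn u < sumn u)%N = false by lia.
rewrite (big_cat_nat (n := sumn u)) ?leq_addr //=; congr (_ + _)%N.
  by apply: eq_big_nat => j /andP[_ ju]; rewrite tail_in.
rewrite -{1}[sumn u]add0n big_addn addKn -tail_length_sum z'm.
by apply: eq_big_nat => i /andP[_ im]; rewrite addnC tail_out.
Qed.

Definition block_poly h m := wsum m (block_weight h).

Lemma wsum_seq_weight h u :
  wsum (sumn u) (seq_weight h u) = \prod_(i < size u) block_poly (h + i) (nth 0%N u i).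
Proof.
elim: u h => [|m u IH] h /=.
  by rewrite big_ord0 /seq_weight !big_geq // mul1r.
rewrite addnC wsum_cat big_ord_recl addn0 /= mulrC.
under [X in _ = X * _]eq_bigr => i _ do rewrite /bump /= add1n -addSnnS.
rewrite -IH -wsum_mulr; apply: eq_wsum => z zu.
rewrite /block_poly -wsum_mull; apply: eq_wsum => z' z'm.
exact: seq_weight_cons.
Qed.

Definition letter_sum h := \sum_x letter_weight h false x.

Definition letter_var h : P := \sum_(b < N | b == h :> nat) y b.

Lemma sum_one_letter h c : (c <= l)%N ->
  \sum_(x : 'I_N * 'I_l.+1 | (x.1 == h :> nat) && (x.2 == c :> nat)) t ^+ (l - x.2) * y x.1 =
  t ^+ (l - c) * letter_var h.
Proof.
move=> cl; rewrite -(pair_big (fun b : 'I_N => b == h :> nat)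
  (fun d : 'I_l.+1 => d == c :> nat) (fun b d => t ^+ (l - d) * y b)) /=.
rewrite mulr_sumr; apply: eq_bigr => b _.
rewrite (big_pred1 (inord c)) => [|d]; first by rewrite inordK.
by rewrite /= -[RHS]val_eqE /= inordK.
Qed.

(** Exactly one letter is fixed, of class [l] in block [h], with weight [y_h]. A first position also
    loses the letter of class 0 in block [h], of weight [t^l y_h]. *)
Lemma sum_letters_case h (F : bool -> P) first :
  \sum_x letter_weight h first x * F (fixed_letter h x) =
  letter_var h * F true +
  (letter_sum h - letter_var h - (if first then t ^+ l * letter_var h else 0)) * F false.
Proof.
have sum_fixed : \sum_(x | fixed_letter h x) letter_weight h first x = letter_var h.
  rewrite -[RHS]mul1r -(expr0 t) -(subnn l) -sum_one_letter //.
  apply: eq_bigr => x /andP[/eqP xh /eqP xl].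
  by rewrite /letter_weight /letter_allowed xh xl leqnn eqn0Ngt l_gt0 andbF !implybT.
have sum_first : \sum_x letter_weight h first x =
    letter_sum h - (if first then t ^+ l * letter_var h else 0).
  case: first {sum_fixed}; last by rewrite subr0.
  apply/eqP; rewrite eq_sym subr_eq -[l in t ^+ l]subn0 -sum_one_letter //.
  rewrite [X in _ + X]big_mkcond -big_split; apply/eqP/eq_bigr => x _ /=.
  rewrite /letter_weight /letter_allowed /=.
  case: (altP (nat_of_ord x.1 =P h)) => [->|_] /=; last by rewrite !andbT addr0.
  rewrite leqnn !implybT; case: (nat_of_ord x.2 == 0%N) => /=; last by rewrite addr0.
  by rewrite add0r.
rewrite (bigID (fixed_letter h)) /=.
rewrite (eq_bigr (fun x => letter_weight h first x * F true)) => [|x -> //].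
rewrite [X in _ + X](eq_bigr (fun x => letter_weight h first x * F false)); last first.
  by move=> x /negbTE ->.
rewrite -!mulr_suml sum_fixed; congr (_ + _ * _).
apply/eqP; rewrite addrAC -sum_first [X in X - _](bigID (fixed_letter h)) /= sum_fixed.
by rewrite addrAC subrr add0r.
Qed.

Lemma block_poly0 h : block_poly h 0 = 1.
Proof. by rewrite /block_poly /= /block_weight /pure_weight big_geq ?mul1r. Qed.

Lemma block_poly1 h :
  block_poly h 1 = r * letter_var h + (letter_sum h - letter_var h - t ^+ l * letter_var h).
Proof.
rewrite /block_poly /=.
under eq_bigr => x _ do rewrite /block_weight /pure_weight big_nat1 /= /tail_length /=.
rewrite -[RHS](addrC) [r * _]mulrC addrC -[X in _ + X]mulr1.
rewrite -(sum_letters_case h (fun b => if b then r else 1) true).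
by apply: eq_bigr => x _; congr (_ * _); case: fixed_letter; rewrite ?expr1 ?expr0.
Qed.

Lemma wsum_pure_weight h a : wsum a.+1 (pure_weight h) =
  (letter_sum h - t ^+ l * letter_var h) * letter_sum h ^+ a.
Proof.
elim: a => [|a IH].
  rewrite /=; under eq_bigr => x _ do rewrite /pure_weight big_nat1 /=.
  under eq_bigr => x _ do rewrite -[letter_weight h true x]mulr1.
  by rewrite (sum_letters_case h (fun=> 1) true) expr0; ring.
rewrite wsum_rcons exprSr mulrA -IH /letter_sum mulr_sumr; apply: eq_bigr => x _.
rewrite -wsum_mulr; apply: eq_wsum => z za.
by rewrite pure_weight_rcons za.
Qed.

(** By the last letter: a fixed one lengthens the tail and gives a factor [r], any other one resets
    the tail and leaves a pure weight. *)
Lemma block_polySS h a : block_poly h a.+2 = r * letter_var h * block_poly h a.+1 +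
  (letter_sum h - letter_var h) * (letter_sum h - t ^+ l * letter_var h) * letter_sum h ^+ a.
Proof.
rewrite {1}/block_poly wsum_rcons.
pose F (b : bool) := if b then r * block_poly h a.+1 else wsum a.+1 (pure_weight h).
transitivity (\sum_x letter_weight h false x * F (fixed_letter h x)).
  apply: eq_bigr => x _.
  case fx : (fixed_letter h x); last first.
    rewrite -[X in _ = _ * X]/(wsum a.+1 (pure_weight h)) -wsum_mull.
    apply: eq_wsum => z za.
    by rewrite /block_weight pure_weight_rcons za tail_length_rcons fx; ring.
  rewrite -[X in _ = _ * X]/(r * block_poly h a.+1) /block_poly -!wsum_mull.
  apply: eq_wsum => z za.
  by rewrite /block_weight pure_weight_rcons za tail_length_rcons fx exprS; ring.
by rewrite (sum_letters_case h F) /F wsum_pure_weight; ring.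
Qed.

End BlockWeights.

Section BlockFactor.
Variables (P : comPzRingType) (ry Z z1 z2 : P).

(** The recursion of [block_poly] over an abstract ring: [Z] is the sum of all letters, [z1] the
    fixed letter, [z2] the letter forbidden in first position. *)
Fixpoint block_factor m : P :=
  match m with
  | 0 => 1
  | 1 => ry + (Z - z1 - z2)
  | (a.+1 as m').+1 => ry * block_factor m' + (Z - z1) * (Z - z2) * Z ^+ a
  end.
End BlockFactor.

(** * Counting words by coefficients of block products *)

Section BlockCoefficients.
Variables (K : comNzRingType) (l N : nat) (t r : K).
Let X (b : 'I_N) : {mpoly K[N]} := 'X_b.

Definition var h : {mpoly K[N]} := letter_var X h.
Definition letters_poly h : {mpoly K[N]} := letter_sum l t%:MP X h.

Definition block_coef h m : {mpoly K[N]} :=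
  block_factor (r%:MP * var h) (letters_poly h) (var h) ((t ^+ l)%:MP * var h) m.

Definition content_mnm (u : seq nat) : 'X_{1..N} := [multinom nth 0%N u i | i < N].

Lemma block_polyE (x0 : 'I_N * 'I_l.+1) h m : (0 < l)%N ->
  block_poly t%:MP r%:MP X x0 h m = block_coef h m.
Proof.
move=> l_gt0; rewrite /block_coef rmorphXn /=; elim: m => [|[|m] IH].
- exact: block_poly0.
- by rewrite block_poly1.
- by rewrite block_polySS // IH.
Qed.
End BlockCoefficients.

Section Coefficients.
Variables (K : comNzRingType) (l : nat) (t r : K) (u : seq nat).
Hypothesis l_gt0 : (0 < l)%N.
Let N := size u.
Let n := sumn u.
Let X (b : 'I_N) : {mpoly K[N]} := 'X_b.

Implicit Type w : {ffun 'I_n -> 'I_N * 'I_l.+1}.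

Lemma nth_word x0 w (j : 'I_n) : nth x0 [seq w i | i <- enum 'I_n] j = w j.
Proof. by rewrite (nth_map j) ?size_enum_ord // nth_ord_enum. Qed.

Lemma seq_weight_word x0 w :
  seq_weight t%:MP r%:MP X x0 0 u [seq w i | i <- enum 'I_n] =
  ((word_ok w)%:R * word_weight t r w)%:MP *
  'X_[(\sum_j U_((w j).1))%MM].
Proof.
rewrite /seq_weight !big_mkord /word_weight.
have -> : (\sum_(j < n) tail_at x0 0 u [seq w i | i <- enum 'I_n] j =
   #|[set j | fixed_tail l (block u) (fun j => (w j).1) (fun j => (w j).2) j]|)%N.
  rewrite -sum1dep_card [RHS]big_mkcond; apply: eq_bigr => j _.
  rewrite /tail_at /fixed_tail add0n.
  set a := [forall _, _]; set b := [forall _, _].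
  have -> : a = b by apply: eq_forallb => j'; rewrite nth_word.
  by case: b.
case: (boolP (word_ok w)) => [/forallP ok | nok].
  rewrite mul1r rmorphM /= !rmorphXn /= mulrAC; congr (_ * _).
  rewrite -prodrXr -mprodXE -big_split /=; apply: eq_bigr => j _.
  by rewrite nth_word add0n /letter_weight [letter_allowed _ _ _](ok j).
case/forallPn: nok => j nok.
rewrite mul0r mpolyC0 mul0r (bigD1 j) //= nth_word add0n /letter_weight.
by rewrite [letter_allowed _ _ _](negbTE nok) !mul0r.
Qed.

Lemma has_content_mnm w :
  ((\sum_j U_((w j).1))%MM == content_mnm N u) = has_content w.
Proof.
apply/eqP/forallP => [e v | cont].
  have /mnmP/(_ v) := e; rewrite mnm_sumE mnmE => <-.
  apply/eqP; rewrite -sum1dep_card [LHS]big_mkcond; apply: eq_bigr => j _.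
  by rewrite mnm1E; case: eqP.
apply/mnmP => v; rewrite mnm_sumE mnmE -(eqP (cont v)).
rewrite -sum1dep_card [RHS]big_mkcond; apply: eq_bigr => j _.
by rewrite mnm1E; case: eqP.
Qed.

(** The variable [y_b] marks the letters of block [b], so a prescribed content is the extraction of
    one monomial. *)
Lemma sum_words_coef_of_letter (x0 : 'I_N * 'I_l.+1) :
  \sum_(w : {ffun 'I_n -> 'I_N * 'I_l.+1} | has_content w && word_ok w) word_weight t r w =
  (\prod_(i < N) block_coef l N t r i (nth 0%N u i))@_(content_mnm N u).
Proof.
under [in RHS]eq_bigr => i _ do rewrite -(block_polyE t r x0) // -[i : nat]add0n.
rewrite -wsum_seq_weight //.
rewrite -(sum_ffun_wsum (sumn u) (seq_weight t%:MP r%:MP X x0 0 u)).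
rewrite (raddf_sum (mcoeff _)) /= big_mkcond.
apply: eq_bigr => w _; rewrite seq_weight_word mcoeffCM mcoeffX has_content_mnm.
by case: has_content; case: word_ok; rewrite /= ?mulr1 ?mulr0 ?mul1r ?mul0r.
Qed.

End Coefficients.

Lemma sum_words_coef (K : comNzRingType) l (t r : K) u N : (0 < l)%N -> size u = N ->
  \sum_(w : {ffun 'I_(sumn u) -> 'I_(size u) * 'I_l.+1} | has_content w && word_ok w)
     word_weight t r w =
  (\prod_(i < N) block_coef l N t r i (nth 0%N u i))@_(content_mnm N u).
Proof.
(* For empty [u] there is no letter to serve as the default of [nth]; that case is computed
   directly. *)
move=> l_gt0 <-; case: u => [|m u]; last first.
  exact: (@sum_words_coef_of_letter K l t r (m :: u) l_gt0 (ord0, ord0)).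
rewrite big_ord0 mcoeff1 (_ : content_mnm _ _ == 0%MM); last by apply/eqP/mnmP => -[].
rewrite (big_pred1 [ffun i : 'I_0 => match notF (ltn_ord i) with end]) => [|w].
  rewrite /word_weight big_ord0 (_ : #|_| = 0%N) ?expr0 ?mulr1 //.
  by apply/eqP; rewrite cards_eq0; apply/eqP/setP => -[].
have -> : @has_content l [::] w && @word_ok l [::] w = true.
  by apply/andP; split; apply/forallP => -[].
by apply/esym/eqP/ffunP => -[].
Qed.

(** * The telescoping identity *)

Section BlockAlgebra.
Variables (P : comPzRingType) (ry Z : P).

Fixpoint homog_factor a : P :=
  if a is a'.+1 then ry * homog_factor a' + Z ^+ a' else 0.

Lemma block_factorC z1 z2 m : block_factor ry Z z1 z2 m = block_factor ry Z z2 z1 m.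
Proof.
elim: m => [|[|m] IH] //; first by rewrite /=; ring.
rewrite -[LHS]/(ry * block_factor ry Z z1 z2 m.+1 + (Z - z1) * (Z - z2) * Z ^+ m) IH /=.
ring.
Qed.

(* With [C], [H] and [K] the generating functions in [x] of [block_factor], of
   the left-hand side and of [homog_factor],
   [C = (1 - z1 x) (1 - z2 x) / ((1 - ry x) (1 - Z x))],
   [K = x / ((1 - ry x) (1 - Z x))] and [H = C / (1 - z1 x)]. *)
Lemma block_factor_geom z1 z2 a :
  \sum_(b < a.+1) z1 ^+ b * block_factor ry Z z1 z2 (a - b) =
  ry ^+ a + (Z - z2) * homog_factor a.
Proof.
(* The coefficients of C = (1 - z1 x) H, where H = 1 / (1 - ry x) + (Z - z2) K. *)
have closed m : block_factor ry Z z1 z2 m.+1 =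
    ry ^+ m.+1 + (Z - z2) * homog_factor m.+1 -
    z1 * (ry ^+ m + (Z - z2) * homog_factor m).
  elim: m => [|m IH]; first by rewrite /= expr0 expr1; ring.
  rewrite -[LHS]/(ry * block_factor ry Z z1 z2 m.+1 + (Z - z1) * (Z - z2) * Z ^+ m) IH /=.
  by rewrite !exprS; ring.
elim: a => [|a IH]; first by rewrite big_ord1 /= expr0; ring.
rewrite big_ord_recl subn0 closed expr0 mul1r.
under eq_bigr => b _ do rewrite lift0 subSS exprS -mulrA.
by rewrite -mulr_sumr IH; ring.
Qed.
End BlockAlgebra.

Section LetterSums.
Variables (P : comNzRingType) (N l : nat) (t : P) (y : 'I_N -> P).

(** Written T_h: in block [h] the two factors Z - z1 and Z - z2 are T_h and T_(h+1). This
    coincidence drives the telescoping. *)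
Definition threshold_sum h : P :=
  \sum_(b < N) (if (h <= b)%N then t * qint t l else qint t l) * y b.

Hypothesis l_gt0 : (0 < l)%N.

Lemma letter_sumE h : letter_sum l t y h = \sum_(b < N)
  ((b <= h)%N%:R + (qint t l - 1) + (h <= b)%N%:R * t ^+ l) * y b.
Proof.
rewrite /letter_sum.
rewrite -(pair_bigA _ (fun b c => letter_weight t y h false (b, c))) /=.
apply: eq_bigr => b _; rewrite (reindex_inj rev_ord_inj) /= /letter_weight /letter_allowed /=.
case: l l_gt0 => // k _; rewrite big_ord_recl big_ord_recr /= /qint big_ord_recl /=.
rewrite !subn1 /= !subSS !subnn subn0 eqxx !expr0 /= [1 + _ - 1]addrC addKr.
rewrite -addrA !mulrDl; congr (_ + _).
  by case: (b <= h)%N; rewrite ?mul0r.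
congr (_ + _); last by case: (h <= b)%N; rewrite ?mul0r ?mul1r.
rewrite mulr_suml; apply: eq_bigr => c _.
have ck := ltn_ord c; rewrite /bump /= add1n subSS.
rewrite ifT; first by congr (_ ^+ _ * _); lia.
by apply/and3P; split=> //; apply/implyP => /eqP; lia.
Qed.

Lemma qintS_sub : t * qint t l = qint t l - 1 + t ^+ l.
Proof.
rewrite /qint; case: l l_gt0 => // k _.
rewrite [X in t * X]big_ord_recr [X in _ = X - _ + _]big_ord_recl /= mulrDr -exprS.
rewrite [1 + _ - 1]addrC addKr mulr_sumr; congr (_ + _).
by apply: eq_bigr => c _; rewrite -exprS.
Qed.

Lemma letter_sum_sub1 h : letter_sum l t y h - letter_var y h = threshold_sum h.
Proof.
rewrite letter_sumE /letter_var [X in _ - X]big_mkcond -sumrB; apply: eq_bigr => b _ /=.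
by rewrite qintS_sub; case: (ltngtP b h) => _ /=; ring.
Qed.

Lemma letter_sum_subl h :
  letter_sum l t y h - t ^+ l * letter_var y h = threshold_sum h.+1.
Proof.
rewrite letter_sumE /letter_var [X in _ * X]big_mkcond mulr_sumr -sumrB.
by apply: eq_bigr => b _ /=; rewrite qintS_sub; case: (ltngtP b h) => _ /=; ring.
Qed.

Lemma threshold_sum_ends : threshold_sum 0 = t * threshold_sum N.
Proof.
rewrite /threshold_sum [RHS]mulr_sumr; apply: eq_bigr => b _.
by rewrite leq0n [(N <= b)%N]leqNgt ltn_ord mulrA.
Qed.

End LetterSums.

(** * Telescoping modulo the monomials that do not divide a given one *)

Section CoefficientModulus.
Variables (K : comNzRingType) (N : nat) (mu : 'X_{1..N}).
Implicit Types p q x : {mpoly K[N]}.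

(** Congruence modulo the ideal spanned by the monomials not dividing ['X_[mu]]; quantifying over
    [x] makes it stable under products. *)
Definition eq_below p q := forall x, (p * x)@_mu = (q * x)@_mu.

Lemma eq_below_coef p q : eq_below p q -> p@_mu = q@_mu.
Proof. by move/(_ 1); rewrite !mulr1. Qed.

Lemma eq_below_trans p q x : eq_below p q -> eq_below q x -> eq_below p x.
Proof. by move=> h1 h2 z; rewrite h1. Qed.

Lemma eq_belowM p q x : eq_below p q -> eq_below (p * x) (q * x).
Proof. by move=> h z; rewrite -!mulrA h. Qed.

Lemma eq_belowD p q p' q' :
  eq_below p q -> eq_below p' q' -> eq_below (p + p') (q + q').
Proof. by move=> h h' z; rewrite !mulrDl !mcoeffD h h'. Qed.

Lemma eq_below_sub p q : eq_below (p - q) 0 -> eq_below p q.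
Proof.
move=> h z; have := h z; rewrite mul0r mcoeff0 mulrBl mcoeffB.
by move/eqP; rewrite subr_eq0 => /eqP.
Qed.

Lemma eq_below_X m : ~~ (m <= mu)%MM -> eq_below 'X_[m] 0.
Proof.
move=> nle x; rewrite mul0r mcoeff0; apply/eqP; apply: contraR nle.
rewrite -mcoeff_msupp mulrC (perm_mem (msuppMX x m)) => /mapP[m' _ ->].
exact: lem_addr.
Qed.

Variables (R T Kf : nat -> {mpoly K[N]}).
Hypothesis T_step : forall h, (h < N)%N -> eq_below (R h * (T h.+1 - T h)) 0.

Let Rprod k := \prod_(i < k) R i.

Lemma Rprod_T k h : (k <= N)%N -> (h < k)%N -> eq_below (Rprod k * (T h.+1 - T h)) 0.
Proof.
move=> kN hk; rewrite /Rprod (bigD1 (Ordinal hk)) //= mulrAC.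
rewrite -[X in eq_below _ X](mul0r (\prod_(i < k | i != Ordinal hk) R i)).
by apply: eq_belowM; apply: T_step; apply: leq_trans kN.
Qed.

Lemma Rprod_T0 k h : (k <= N)%N -> (h <= k)%N -> eq_below (Rprod k * (T h - T 0%N)) 0.
Proof.
move=> kN; elim: h => [|h IH] hk; first by rewrite subrr mulr0.
rewrite -(subrK (T h) (T h.+1)) -addrA mulrDr -[X in eq_below _ X]addr0.
by apply: eq_belowD; [apply: Rprod_T | apply/IH/ltnW].
Qed.

Fixpoint cofactor_sum k := if k is k'.+1 then
    cofactor_sum k' * R k' + Rprod k' * Kf k' + T k' * cofactor_sum k' * Kf k'
  else 0.

(** Both products have the same cofactor. In the first, [T k] may be replaced by [T 0] next to R_0
    ... R_(k-1); in the second, [T k] by [T k.+1] next to [R k]. If T_0 = c T_N, the cofactors then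
    cancel. *)
Lemma prod_telescope k : (k <= N)%N ->
  eq_below (\prod_(i < k) (R i + T i * Kf i)) (Rprod k + T 0%N * cofactor_sum k) /\
  eq_below (\prod_(i < k) (R i + T i.+1 * Kf i)) (Rprod k + T k * cofactor_sum k).
Proof.
elim: k => [|k IH] kN; first by rewrite /Rprod !big_ord0 mulr0 addr0.
have [IH1 IH2] := IH (ltnW kN).
have RprodS : Rprod k.+1 = Rprod k * R k by rewrite /Rprod big_ord_recr.
rewrite ![\prod_(i < k.+1) _]big_ord_recr /=; split.
  apply: eq_below_trans (eq_belowM _ IH1) _; apply: eq_below_sub.
  apply: eq_below_trans (_ : eq_below (Rprod k * (T k - T 0%N) * Kf k) 0).
    rewrite RprodS; set a := T 0%N; set b := T k.
    by rewrite (_ : _ - _ = Rprod k * (b - a) * Kf k) //; ring.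
  rewrite -[X in eq_below _ X](mul0r (Kf k)); apply: eq_belowM.
  exact: Rprod_T0 (ltnW kN) (leqnn k).
apply: eq_below_trans (eq_belowM _ IH2) _; apply: eq_below_sub.
apply: eq_below_trans (_ : eq_below (R k * (T k.+1 - T k) * - cofactor_sum k) 0).
  rewrite RprodS; set a := T k.+1; set b := T k.
  by rewrite (_ : _ - _ = R k * (a - b) * - cofactor_sum k) //; ring.
rewrite -[X in eq_below _ X](mul0r (- cofactor_sum k)); apply: eq_belowM.
exact: T_step.
Qed.

Lemma coef_telescope c : T 0%N = c * T N ->
  (\prod_(i < N) (R i + T i * Kf i) - c * \prod_(i < N) (R i + T i.+1 * Kf i))@_mu =
  ((1 - c) * \prod_(i < N) R i)@_mu.
Proof.
move=> T0; have [h1 h2] := prod_telescope (leqnn N).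
rewrite mcoeffB (eq_below_coef h1).
have := h2 c; rewrite ![_ * c]mulrC => ->.
rewrite -mcoeffB T0 /Rprod; congr (_@_mu); ring.
Qed.
End CoefficientModulus.

Section ConvCoefficient.
Variables (K : fieldType) (N : nat).
Local Notation mpolyN := {mpoly K[N]}.

Lemma var_ord h (hN : (h < N)%N) : var K N h = 'X_(Ordinal hN).
Proof. by rewrite /var /letter_var (big_pred1 (Ordinal hN)). Qed.

Lemma content_mnm_shift pre s m j (hN : (size pre < N)%N) : (j <= m)%N ->
  content_mnm N (pre ++ m :: s) =
  (U_(Ordinal hN) *+ j + content_mnm N (rcons pre (m - j)%N ++ s))%MM.
Proof.
move=> jm; apply/mnmP => i; rewrite mnmDE mulmnE mnm1E !mnmE cat_rcons !nth_cat.
rewrite -val_eqE /=; case: (ltngtP i (size pre)) => [ip | pi | ->] //=;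
  rewrite ?mul0n ?mul1n ?add0n //.
- by have -> : (i - size pre = (i - size pre).-1.+1)%N by lia.
- by rewrite subnn /= subnKC.
Qed.

(** Lowering an entry of the content by [b] amounts to multiplying by the [b]-th power of its
    variable. The prefix [pre] holds the entries already treated. *)
Lemma conv_coef (a : K) (C : nat -> nat -> mpolyN) pre (Q : mpolyN) s :
  (size pre + size s)%N = N ->
  conv a (fun u => (Q * \prod_(i < size u) C (size pre + i)%N (nth 0%N u i))@_
                     (content_mnm N (pre ++ u))) s =
  (Q * \prod_(i < size s) \sum_(b < (nth 0%N s i).+1)
     (a%:MP * var K N (size pre + i)) ^+ b *
       C (size pre + i)%N (nth 0%N s i - b)%N)@_(content_mnm N (pre ++ s)).
Proof.
elim: s pre Q => [|m s IH] pre Q szN /=; first by rewrite !big_ord0.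
have hN : (size pre < N)%N by rewrite -szN -addSnnS leq_addr.
rewrite [in RHS]big_ord_recl /= addn0 big_distrl /= mulr_sumr (raddf_sum (mcoeff _)) /=.
apply: eq_bigr => j _; have jm : (j <= m)%N by rewrite -ltnS.
rewrite (content_mnm_shift s hN jm).
set pre' := rcons pre (m - j)%N.
have szpre' i : (size pre + i.+1 = size pre' + i)%N by rewrite size_rcons addSnnS.
transitivity (a ^+ j * (conv a (fun u => (Q * C (size pre) (m - j)%N *
   \prod_(i < size u) C (size pre' + i)%N (nth 0%N u i))@_(content_mnm N (pre' ++ u))) s)).
  congr (_ * _); apply: eq_conv => u _.
  rewrite big_ord_recl /= addn0 mulrA cat_rcons; congr (_@__); congr (_ * _).
  by apply: eq_bigr => i _; rewrite /bump /= add1n szpre'.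
rewrite IH ?size_rcons ?addSnnS // var_ord exprMn -rmorphXn /= mpolyXn.
under [in RHS]eq_bigr => i _ do rewrite /bump /= add1n szpre'.
rewrite -mcoeffCM -(mcoeffMX _ (U_(Ordinal hN) *+ j)%MM).
by congr (_@__); rewrite size_rcons; ring.
Qed.
End ConvCoefficient.

Section BlockCount.
Variables (K : fieldType) (l : nat) (t r : K).
Hypothesis l_gt0 : (0 < l)%N.

(* The colored permutations whose class word is weakly increasing, and whose
   letters increase within a class, on each of the blocks of [u]. *)
Definition block_count (u : seq nat) : K :=
  \sum_(s : {perm 'I_(sumn u)}) \sum_(k : {ffun 'I_(sumn u) -> 'I_l.+1} | class_ok s k)
     (cuts_at (class_desc s k) (sumn u) u)%:R * class_weight t r s k.

Lemma conv_block_count a s : conv a block_count s =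
  (\prod_(i < size s) \sum_(b < (nth 0%N s i).+1)
     (a%:MP * var K (size s) i) ^+ b *
       block_coef l (size s) t r i (nth 0%N s i - b)%N)@_(content_mnm (size s) s).
Proof.
set N := size s.
have := @conv_coef K N a (block_coef l N t r) [::] 1 s erefl; rewrite mul1r => <-.
apply: eq_conv => u uN; rewrite mul1r /block_count sum_class_words (sum_words_coef _ _ l_gt0 uN).
by rewrite uN.
Qed.

Lemma block_count_identity s :
  conv (t ^+ l) block_count s - t * conv 1 block_count s = (1 - t) * r ^+ sumn s.
Proof.
set N := size s; rewrite !conv_block_count -/N.
pose X (b : 'I_N) : {mpoly K[N]} := 'X_b.
pose ry i := r%:MP * var K N i.
pose R i := ry i ^+ nth 0%N s i.
pose T := threshold_sum l t%:MP X.
pose Kf i := homog_factor (ry i) (letters_poly l N t i) (nth 0%N s i).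
have z1T i : letters_poly l N t i - var K N i = T i by apply: letter_sum_sub1.
have z2T i : letters_poly l N t i - (t ^+ l)%:MP * var K N i = T i.+1.
  by rewrite rmorphXn; apply: letter_sum_subl.
(* The geometric series in [z2] cancels the factor for [z2] and leaves Z - z1 = T_i; below, the one
   in [z1] leaves T_(i+1). *)
have -> : \prod_(i < N) \sum_(b < (nth 0%N s i).+1) ((t ^+ l)%:MP * var K N i) ^+ b *
     block_coef l N t r i (nth 0%N s i - b) = \prod_(i < N) (R i + T i * Kf i).
  apply: eq_bigr => i _; rewrite -z1T -(block_factor_geom _ _ ((t ^+ l)%:MP * var K N i)).
  by apply: eq_bigr => b _; rewrite block_factorC.
have -> : \prod_(i < N) \sum_(b < (nth 0%N s i).+1) (1%:MP * var K N i) ^+ b *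
     block_coef l N t r i (nth 0%N s i - b) = \prod_(i < N) (R i + T i.+1 * Kf i).
  apply: eq_bigr => i _; rewrite -z2T -(block_factor_geom _ _ (var K N i)).
  by apply: eq_bigr => b _; rewrite mpolyC1 mul1r.
rewrite -mcoeffCM -mcoeffB (@coef_telescope _ _ (content_mnm N s) R T Kf).
- rewrite -mpolyC1 -mpolyCB mcoeffCM; congr (_ * _).
  have -> : \prod_(i < N) R i = (r ^+ sumn s)%:MP * 'X_[content_mnm N s].
    rewrite /R /ry; under eq_bigr => i _ do rewrite exprMn.
    rewrite big_split /= prodrXr -rmorphXn /=; congr (_%:MP * _).
      by congr (_ ^+ _); rewrite sumnE (big_nth 0%N) big_mkord.
    rewrite (mpolyXE_id _ (content_mnm N s)); apply: eq_bigr => i _.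
    rewrite (var_ord _ (ltn_ord i)) mnmE.
    by have -> : Ordinal (ltn_ord i) = i by apply: val_inj.
  by rewrite mcoeffCM mcoeffX eqxx mulr1.
- move=> h hN; rewrite -z2T -z1T.
  (* T_(h+1) - T_h = (1 - t^l) y_h, so the product contains one more power of y_h than the target
     monomial allows. *)
  have -> : R h * (letters_poly l N t h - (t ^+ l)%:MP * var K N h -
      (letters_poly l N t h - var K N h)) =
     'X_[U_(Ordinal hN) *+ (nth 0%N s h).+1] *
       (r%:MP ^+ nth 0%N s h * (1 - (t ^+ l)%:MP)).
    by rewrite /R /ry -mpolyXn exprMn (var_ord _ hN) exprS; ring.
  rewrite -[X in eq_below _ _ X](mul0r (r%:MP ^+ nth 0%N s h * (1 - (t ^+ l)%:MP))).
  apply: eq_belowM; apply: eq_below_X; apply/negP => /mnm_lepP/(_ (Ordinal hN)).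
  by rewrite mulmnE mnm1E eqxx mul1n mnmE ltnn.
- by rewrite /T threshold_sum_ends.
Qed.
End BlockCount.

(** * The generating function identity *)

Lemma block_eq_zero s1 s2 i j :
  (i < sumn (s1 ++ s2))%N -> (j < sumn (s1 ++ s2))%N ->
  (block (s1 ++ 0%N :: s2) i == block (s1 ++ 0%N :: s2) j) =
  (block (s1 ++ s2) i == block (s1 ++ s2) j).
Proof.
elim: s1 i j => [|m s1 IH] i j /=; first by move=> -> ->.
have -> : sumn (s1 ++ 0%N :: s2) = sumn (s1 ++ s2) by rewrite !sumn_cat.
by move=> _ _; do 2?case: ltnP => ?; rewrite ?eqSS ?IH.
Qed.

Section ColoredPolynomial.
Variable l : nat.

(** The truncated exponent is exact because [maj_class] gives [exc <= maj]. Without negative powers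
    of [q], the sum commutes with ring morphisms. *)
Definition colored_poly (R : comNzRingType) n (t r q : R) : R :=
  \sum_(pi : colperm l n) t ^+ fexc pi * r ^+ fixc pi * q ^+ (maj pi - exc pi).

Lemma rmorph_colored_poly (R S : comNzRingType) (f : {rmorphism R -> S}) n t r q :
  f (colored_poly n t r q) = colored_poly n (f t) (f r) (f q).
Proof.
rewrite rmorph_sum; apply: eq_bigr => pi _.
by rewrite !rmorphM !rmorphXn.
Qed.

Hypothesis l_gt0 : (0 < l)%N.

Lemma AcolE (R : fieldType) n (t r q : R) : Acol l n t r q = colored_poly n t r q.
Proof.
apply: eq_bigr => pi _; congr (_ * _); rewrite maj_class //.
by rewrite PoszD addrK -[(_ + _ - _)%N]addnBA // subnn addn0.
Qed.

Variables (K : fieldType) (t r q : K).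

Lemma block_count_zero_blind : zero_blind (block_count l t r).
Proof.
move=> s1 s2; rewrite /block_count.
have cutsE d : cuts_at d (sumn (s1 ++ s2)) (s1 ++ 0%N :: s2) =
    cuts_at d (sumn (s1 ++ s2)) (s1 ++ s2).
  apply: eq_forallb => i; congr (_ ==> ~~ _); apply: block_eq_zero => //.
  exact: leq_ltn_trans (leq_pred _) (ltn_ord i).
have -> : sumn (s1 ++ 0%N :: s2) = sumn (s1 ++ s2) by rewrite !sumn_cat.
by apply: eq_bigr => s _; apply: eq_bigr => k _; rewrite cutsE.
Qed.

Hypothesis q_generic : forall i, (0 < i)%N -> q ^+ i != 1.

Lemma level_sum_block_count n :
  level_sum q n (block_count l t r) = colored_poly n t r q / qpoch q n.
Proof.
transitivity (level_sum q n (fun u => \sum_(s : {perm 'I_n})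
    \sum_(k : {ffun 'I_n -> 'I_l.+1}) (if class_ok s k then class_weight t r s k else 0) *
     (cuts_at (class_desc s k) n u)%:R)).
  apply: eq_level_sum => // u; rewrite /block_count => <-.
  apply: eq_bigr => s _; rewrite big_mkcond; apply: eq_bigr => k _.
  by case: ifP => _; rewrite ?mul0r // mulrC.
rewrite level_sum_sum // /colored_poly.
transitivity (\sum_(s : {perm 'I_n}) \sum_(k : {ffun 'I_n -> 'I_l.+1} | class_ok s k)
   class_weight t r s k * q ^+ (\sum_(1 <= i < n | class_desc s k i) i) / qpoch q n).
  apply: eq_bigr => s _; rewrite level_sum_sum // [RHS]big_mkcond; apply: eq_bigr => k _.
  rewrite level_sumZ // level_sum_cuts // mulrA.
  by case: ifP => _; rewrite ?mul0r.
rewrite -(sum_colperm l_gt0 (fun s k =>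
  class_weight t r s k * q ^+ (\sum_(1 <= i < n | class_desc s k i) i) / qpoch q n)).
rewrite mulr_suml; apply: eq_bigr => pi _.
rewrite /class_weight fexc_class // fixc_class // maj_class //.
by rewrite -[(_ + _ - _)%N]addnBA // subnn addn0.
Qed.

(** The coefficient of z^n in D F = (1 - t) e(r z), obtained by applying [level_sum] to
    [block_count_identity]. *)
Lemma colored_poly_conv n :
  \sum_(k < n.+1) (t ^+ (l * k) - t) / qpoch q k *
     (colored_poly (n - k) t r q / qpoch q (n - k)) =
  (1 - t) * r ^+ n / qpoch q n.
Proof.
have one_cuts : level_sum q n (fun=> 1) = 1 / qpoch q n.
  have := level_sum_cuts q_generic pred0 n; rewrite big_pred0_eq expr0 => <-.
  apply: eq_level_sum => // s _.
  by rewrite (_ : cuts_at _ _ _) //; apply/forallP => i; rewrite andbF.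
transitivity (level_sum q n (fun s => conv (t ^+ l) (block_count l t r) s +
    (- t) * conv 1 (block_count l t r) s)).
  rewrite level_sumD // level_sumZ // !level_sum_conv //;
    try exact: block_count_zero_blind.
  rewrite mulr_sumr -big_split /=; apply: eq_bigr => k _.
  by rewrite level_sum_block_count expr1n -exprM; ring.
transitivity (level_sum q n (fun=> (1 - t) * r ^+ n * 1)).
  apply: eq_level_sum => // s sn.
  by rewrite mulNr block_count_identity // sn mulr1.
by rewrite level_sumZ // one_cuts; ring.
Qed.
End ColoredPolynomial.

(** * Truncated power series and the recurrence *)

Lemma eq_modXn (K : idomainType) M (p p' : {poly K}) :
  (forall i, (i < M)%N -> p`_i = p'`_i) -> exists u, p = p' + 'X^M * u.
Proof.
move=> e; exists (drop_poly M p - drop_poly M p').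
have et : take_poly M p = take_poly M p'.
  by apply/polyP => i; rewrite !coef_take_poly; case: ifP => // /e.
have ep := poly_take_drop M p; have ep' := poly_take_drop M p'.
rewrite -[LHS]ep et; set v := drop_poly M p; set w := drop_poly M p'.
by rewrite -[X in X + _ * (_ - _)]ep' -/w; ring.
Qed.

(** A polynomial with nonzero constant term is coprime to ['X^M], hence cancels modulo it. *)
Lemma modXn_cancel (K : fieldType) M (d p u : {poly K}) :
  d`_0 != 0 -> d * p = 'X^M * u -> forall i, (i < M)%N -> p`_i = 0.
Proof.
move=> d0 e i iM.
have : 'X^M %| p.
  rewrite -(@Gauss_dvdpr _ _ d); first by rewrite e dvdp_mulr.
  rewrite coprimep_expl // coprimep_sym coprimepX.
  by rewrite /root horner_coef0.
by case/dvdpP => v ->; rewrite coefMXn iM.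
Qed.

(** [Y] stands for the truncating power of z, [X] for z, and a prime for z -> q z. Explicit
    remainders turn the elimination modulo [Y] into a ring identity. *)
Lemma difference_certificate (P : comPzRingType)
    (D D' F F' G E R R' X Y u1 u2 u3 u4 u5 r c s w : P) :
  D * F = R + Y * u1 -> D' * F' = R' + Y * u2 -> D * G = w * E + Y * u3 ->
  R - R' = r * (X * R) + Y * u4 -> D - D' = X * (c * D - s * w * E) + Y * u5 ->
  D * (F - F' - X * (r * F - c * F' + s * (F' * G))) =
  Y * (u1 - u2 + u4 - r * X * u1 - F' * u5 - s * X * F' * u3).
Proof.
move=> eu1 eu2 eu3 eu4 eu5.
have -> : D * (F - F' - X * (r * F - c * F' + s * (F' * G))) =
    D * F - D' * F' - (D - D') * F' - X * (r * (D * F) - c * D * F' + s * F' * (D * G)).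
  by ring.
have eR' : R' = R - (r * (X * R) + Y * u4) by rewrite -eu4 opprB addrC subrK.
by rewrite eu1 eu2 eu3 eu5 eR'; ring.
Qed.

Section Recurrence.
Variables (K : fieldType) (t r q : K) (l n : nat) (a g : nat -> K).
Hypothesis q_generic : forall i, (0 < i)%N -> q ^+ i != 1.
Hypothesis t_neq1 : t != 1.
Let d k := (t ^+ (l * k) - t) / qpoch q k.
Hypothesis a_conv : forall m, \sum_(k < m.+1) d k * a (m - k)%N =
  (1 - t) * r ^+ m / qpoch q m.
Hypothesis g_conv : forall m, \sum_(k < m.+1) d k * g (m - k)%N =
  (1 - t) / qpoch q m.

(** The coefficient of z^(n+1) is the highest one needed. *)
Let M := n.+2.
Let gen (c : nat -> K) : {poly K} := \poly_(i < M) c i.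

Let genM (c c' : nat -> K) i : (i < M)%N ->
  (gen c * gen c')`_i = \sum_(k < i.+1) c k * c' (i - k)%N.
Proof.
move=> iM; rewrite coefM; apply: eq_bigr => k _.
rewrite !coef_poly (leq_ltn_trans (leq_subr _ _) iM).
by rewrite (leq_ltn_trans _ iM) // -ltnS.
Qed.

Let geni c i : (i < M)%N -> (gen c)`_i = c i.
Proof. by move=> iM; rewrite coef_poly iM. Qed.

Let coefXMS (p : {poly K}) i : ('X * p)`_i.+1 = p`_i.
Proof. by rewrite coefXM. Qed.

Let genX0 c : ('X * gen c)`_0 = 0.
Proof. by rewrite coefXM. Qed.

(* Comparing the identity [D F = (1 - t) e(r z)] with its image under
   [z -> q z], and using [e(z) - e(q z) = z e(z)] and [(1 - t) e = D G], gives
   [D * (F - F(q z) - z (r F - t^l F(q z) + t [l]_t F(q z) G)) = 0]. *)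
Lemma conv_recurrence :
  (1 - q ^+ n.+1) * a n.+1 = r * a n - t ^+ l * q ^+ n * a n +
    t * qint t l * \sum_(k < n.+1) q ^+ k * a k * g (n - k)%N.
Proof.
pose sc (c : nat -> K) k := q ^+ k * c k.
pose e k := (qpoch q k)^-1.
pose er k := (1 - t) * r ^+ k / qpoch q k.
pose F := gen a; pose F' := gen (sc a); pose D := gen d; pose D' := gen (sc d).
pose G := gen g; pose E := gen e; pose R := gen er; pose R' := gen (sc er).
have qp0 k : qpoch q k != 0 by apply: qpoch_neq0.
have q1 k : 1 - q ^+ k.+1 != 0 by apply: oneBq_neq0.
have [u1 eu1] : exists u, D * F = R + 'X^M * u.
  by apply: eq_modXn => i iM; rewrite genM // geni // a_conv.
have [u2 eu2] : exists u, D' * F' = R' + 'X^M * u.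
  apply: eq_modXn => i iM; rewrite genM // geni // /sc /er -a_conv mulr_sumr.
  apply: eq_bigr => k _; rewrite mulrACA -exprD subnKC // -ltnS //.
have [u3 eu3] : exists u, D * G = (1 - t)%:P * E + 'X^M * u.
  by apply: eq_modXn => i iM; rewrite genM // g_conv coefCM geni.
have [u4 eu4] : exists u, R - R' = r%:P * ('X * R) + 'X^M * u.
  apply: eq_modXn => -[|i] iM; rewrite coefB coefCM !geni //.
    by rewrite genX0 mulr0 /sc expr0 mul1r subrr.
  by rewrite coefXMS (geni _ (ltnW iM)) /sc /er qpochS exprS; field; rewrite qp0 q1.
(* The numerators satisfy t^(l(i+1)) - t = t^l (t^(li) - t) + t (t^l - 1). *)
have [u5 eu5] : exists u, D - D' =
    'X * ((t ^+ l)%:P * D + (t * (t ^+ l - 1))%:P * E) + 'X^M * u.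
  apply: eq_modXn => -[|i] iM; rewrite coefB !geni //.
    by rewrite coefXM /= /sc expr0 mul1r subrr.
  rewrite coefXMS coefD !coefCM !(geni _ (ltnW iM)) /sc /d /e qpochS mulnS exprD exprS.
  move: (qp0 i) (q1 i); rewrite -exprS.
  move: (qpoch q i) (q ^+ i.+1) (t ^+ (l * i)) (t ^+ l) => x y v z x0 y0.
  by field; rewrite x0 y0.
have tl : t ^+ l - 1 = - (qint t l * (1 - t)).
  by rewrite subrX1 -mulrN opprB mulrC.
have eu5' : D - D' =
    'X * ((t ^+ l)%:P * D - (t * qint t l)%:P * (1 - t)%:P * E) + 'X^M * u5.
  by rewrite eu5 tl mulrN polyCN mulNr mulrA polyCM.
have E0 : (F - F' - 'X * (r%:P * F - (t ^+ l)%:P * F' + (t * qint t l)%:P * (F' * G)))`_n.+1 = 0.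
  apply: modXn_cancel (difference_certificate eu1 eu2 eu3 eu4 eu5') _ _ => //.
  by rewrite geni // /d muln0 expr0 qpoch0 divr1 subr_eq0 eq_sym.
move: E0; rewrite coefB coefB coefXMS coefD coefB !coefCM !geni // genM //.
rewrite /sc => /eqP; rewrite subr_eq0 -{1}[a n.+1]mul1r -mulrBl => /eqP ->.
by rewrite mulrA.
Qed.
End Recurrence.

(** * Specialization *)

(** The q-Pascal rule gives Gaussian polynomials without division, so they survive
    specialization. *)
Fixpoint gauss (R : comNzRingType) (q : R) n k : R :=
  match n, k with
  | _, 0 => 1
  | 0, _.+1 => 0
  | n'.+1, k'.+1 => gauss q n' k' + q ^+ k * gauss q n' k
  end.

Lemma rmorph_gauss (R S : comNzRingType) (f : {rmorphism R -> S}) q n k :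
  f (gauss q n k) = gauss (f q) n k.
Proof.
elim: n k => [|n IH] [|k] /=; rewrite ?rmorph1 ?rmorph0 //.
by rewrite rmorphD rmorphM rmorphXn !IH.
Qed.

Lemma gauss_small (R : comNzRingType) (q : R) n k : (n < k)%N -> gauss q n k = 0.
Proof.
by elim: n k => [|n IH] [|k] //= nk; rewrite !IH ?mulr0 ?addr0 // ltnW.
Qed.

Lemma gauss_qpoch (R : fieldType) (q : R) m k :
  gauss q (k + m) k * (qpoch q k * qpoch q m) = qpoch q (k + m).
Proof.
move: {2}(k + m)%N (erefl (k + m)%N) => n; elim: n k m => [|n IH] [|k] [|m] // kmn.
- by rewrite !addn0 /= qpoch0; ring.
- by rewrite add0n /= qpoch0; ring.
- have kn : (k + 0)%N = n by move: kmn; rewrite addSn => -[].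
  rewrite addn0 [gauss _ _ _]/= (@gauss_small _ q k k.+1) // !qpochS mulr0 addr0 qpoch0.
  by have := IH k 0%N kn; rewrite addn0 qpoch0 => e; rewrite -[in RHS]e; ring.
- have kn : (k + m.+1)%N = n by move: kmn; rewrite addSn => -[].
  have kn' : (k.+1 + m)%N = n by rewrite addSnnS.
  rewrite addSn [gauss _ _ _]/= !qpochS mulrDl.
  (* The two parts recombine by (1 - q^(k+1)) + q^(k+1) (1 - q^(m+1)) = 1 - q^(k+m+2). *)
  transitivity (gauss q (k + m.+1) k * (qpoch q k * qpoch q m.+1) * (1 - q ^+ k.+1) +
    gauss q (k.+1 + m) k.+1 * (qpoch q k.+1 * qpoch q m) * (q ^+ k.+1 * (1 - q ^+ m.+1))).
    by rewrite addSnnS !qpochS; ring.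
  rewrite IH // IH // kn kn' -[n.+1]kmn exprD; ring.
Qed.

Lemma qbinomE (R : fieldType) (q : R) n k :
  (forall i, (0 < i <= n)%N -> q ^+ i != 1) -> (k <= n)%N -> qbinom q n k = gauss q n k.
Proof.
move=> qn kn; rewrite /qbinom -{1}(subnKC kn) -gauss_qpoch subnKC // mulfK //.
have nz m : (m <= n)%N -> qpoch q m != 0.
  elim: m => [|m IH] mn; first by rewrite qpoch0 oner_neq0.
  by rewrite qpochS mulf_neq0 ?IH ?(ltnW mn) // subr_eq0 eq_sym qn.
by rewrite mulf_neq0 ?nz // leq_subr.
Qed.

Lemma colored_poly0 (R : comNzRingType) l (t r q : R) : colored_poly l 0 t r q = 1.
Proof.
rewrite /colored_poly (eq_bigr (fun=> 1)) => [|pi _].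
  by rewrite sumr_const card_prod card_Sn card_ffun !card_ord expn0.
have no_pos (A : {set 'I_0}) : #|A| = 0%N by apply/eqP; rewrite cards_eq0; apply/eqP/setP => -[].
by rewrite /fexc /fixc /exc /maj !no_pos big_ord0 big_geq // muln0 !expr0 !mulr1.
Qed.

Lemma rmorph_qint (R S : comNzRingType) (f : {rmorphism R -> S}) (t : R) m :
  f (qint t m) = qint (f t) m.
Proof. by rewrite rmorph_sum; apply: eq_bigr => i _; rewrite rmorphXn. Qed.

Section RecurrenceRhs.
Variables (l n : nat).

Definition recurrence_rhs (R : comNzRingType) (t r q : R) :=
    (r + t * qint t l.-1 * q ^+ n) * colored_poly l n t r q
    + t * qint t l *
      \sum_(k < n) gauss q n k * q ^+ k * colored_poly l k t r q * colored_poly l (n - k) t 1 q.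

Lemma rmorph_recurrence_rhs (R S : comNzRingType) (f : {rmorphism R -> S}) t r q :
  f (recurrence_rhs t r q) = recurrence_rhs (f t) (f r) (f q).
Proof.
rewrite /recurrence_rhs rmorphD !rmorphM rmorphD !rmorphM !rmorph_qint rmorphXn.
rewrite rmorph_colored_poly rmorph_sum; congr (_ + _ * _); apply: eq_bigr => k _.
by rewrite !rmorphM rmorph_gauss rmorphXn !rmorph_colored_poly rmorph1.
Qed.
End RecurrenceRhs.

Lemma colored_recurrence_generic (K : fieldType) l n (t r q : K) : (0 < l)%N ->
  (forall i, (0 < i)%N -> q ^+ i != 1) -> t != 1 ->
  colored_poly l n.+1 t r q = recurrence_rhs l n t r q.
Proof.
move=> l_gt0 q_generic t1.
have qp0 m : qpoch q m != 0 by apply: qpoch_neq0.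
have q1 : 1 - q ^+ n.+1 != 0 by apply: oneBq_neq0.
have := @conv_recurrence K t r q l n (fun m => colored_poly l m t r q / qpoch q m)
  (fun m => colored_poly l m t 1 q / qpoch q m) q_generic t1
  (colored_poly_conv l_gt0 t r q_generic).
have conv1 m : \sum_(k < m.+1) (t ^+ (l * k) - t) / qpoch q k *
    (colored_poly l (m - k) t 1 q / qpoch q (m - k)) = (1 - t) / qpoch q m.
  by rewrite colored_poly_conv // expr1n mulr1.
move=> /(_ conv1) /(congr1 ( *%R (qpoch q n))).
have -> : qpoch q n * ((1 - q ^+ n.+1) * (colored_poly l n.+1 t r q / qpoch q n.+1)) =
    colored_poly l n.+1 t r q.
  by rewrite qpochS; field; rewrite qp0 q1.
rewrite /recurrence_rhs => ->.
(* The term [k = n] gives t [l]_t q^n A_n, which joins - t^l q^n A_n to form t [l-1]_t q^n A_n. *)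
rewrite big_ord_recr /= subnn colored_poly0 qpoch0.
set S := \sum_(k < n) _; set S' := \sum_(k < n) _.
have -> : S = S' / qpoch q n.
  rewrite /S /S' mulr_suml; apply: eq_bigr => k _.
  have kn : (k <= n)%N by apply: ltnW.
  rewrite -(@qbinomE _ q n k) // => [|i /andP[i0 _]]; last exact: q_generic.
  by rewrite /qbinom; field; rewrite !qp0.
have -> : t * qint t l.-1 = t * qint t l - t ^+ l.
  case: l l_gt0 {S S' conv1} => // l' _.
  by rewrite /qint big_ord_recr /= mulrDr -exprS addrK.
by field; rewrite oner_neq0 qp0.
Qed.

Lemma colored_recurrence (R : fieldType) l n (t r q : R) : (0 < l)%N ->
  colored_poly l n.+1 t r q = recurrence_rhs l n t r q.
Proof.
move=> l_gt0; pose S := {poly {poly R}}.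
pose f : {rmorphism S -> {fraction S}} := @tofrac S.
have f_inj : injective f by move=> x y /eqP; rewrite tofrac_eq => /eqP.
(* The outer indeterminate plays [t], the inner one [q]; [r] is arbitrary in the generic recurrence
   and stays a constant. *)
pose q' : S := 'X%:P; pose r' : S := r%:P%:P.
have S_rec : colored_poly l n.+1 'X r' q' = recurrence_rhs l n 'X r' q'.
  apply: (f_inj); rewrite rmorph_colored_poly rmorph_recurrence_rhs.
  apply: colored_recurrence_generic => // [i i0|].
    rewrite -rmorphXn -(rmorph1 f) (inj_eq f_inj) /q' -polyC_exp -polyC1 (inj_eq polyC_inj).
    by apply/eqP => /(congr1 (fun p : {poly R} => size p)); rewrite size_polyXn size_poly1; case: i i0.
  rewrite -(rmorph1 f) (inj_eq f_inj).
  by apply/eqP => /(congr1 (fun p : S => size p)); rewrite size_polyX size_poly1.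
pose ev : {rmorphism S -> R} := horner_eval q \o horner_eval t%:P.
have := congr1 ev S_rec; rewrite rmorph_colored_poly rmorph_recurrence_rhs /ev /=.
by rewrite /horner_eval !hornerE.
Qed.

Theorem theorem4p22 (R : fieldType) (l n : nat) (t r q : R) :
  (0 < l)%N ->
  (forall i : nat, (0 < i <= n)%N -> q ^+ i != 1) ->
  Acol l 0 t r q = 1 /\
  Acol l n.+1 t r q =
    (r + t * qint t l.-1 * q ^+ n) * Acol l n t r q
    + t * qint t l *
      \sum_(0 <= k < n) qbinom q n k * q ^+ k * Acol l k t r q * Acol1 l (n - k) t q.
Proof.
move=> l_gt0 qn; rewrite /Acol1 !AcolE // colored_poly0; split=> //.
rewrite colored_recurrence // /recurrence_rhs big_mkord; congr (_ + _ * _).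
by apply: eq_bigr => k _; rewrite !AcolE // qbinomE // ltnW.
Qed.
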